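(* Let $Q$ be a bounded real-valued random variable whose distribution is not supported on at most two points. Then there exists $\zeta\in\mathbb C^+$ with $|\zeta|>1$ such that $$\inf_{w\in\mathbb R}\ \mathbb E\Big[\log\frac{|\zeta|^2\,|w+1/\zeta-Q|^2}{|w-\zeta|^2}\Big]>0.$$ *)

(* Defs.v *)
From HB Require Import structures.
From mathcomp Require Import all_boot all_order all_algebra.
From mathcomp Require Import all_classical all_reals all_analysis.
From mathcomp.real_closed Require Import complex.
Set Implicit Arguments. Unset Strict Implicit. Unset Printing Implicit Defensive.
Import Order.TTheory GRing.Theory Num.Theory.
Local Open Scope ring_scope.

Definition kernel5p1 (R : realType) (zeta : R[i]) (w q : R) : R :=
  ln ((Normc.normc zeta) ^+ 2 * (Normc.normc ((w%:C + zeta^-1 - q%:C)%C)) ^+ 2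
      / (Normc.normc ((w%:C - zeta)%C)) ^+ 2).

(* Main.v *)
Require Import Defs.
From HB Require Import structures.
From mathcomp Require Import all_boot all_order all_algebra.
From mathcomp Require Import all_classical all_reals all_analysis.
From mathcomp.real_closed Require Import complex.
From mathcomp Require Import measurable_realfun ring lra.
Set Implicit Arguments. Unset Strict Implicit. Unset Printing Implicit Defensive.
Import Order.TTheory GRing.Theory Num.Theory.
Import numFieldNormedType.Exports.
Local Open Scope classical_set_scope.
Local Open Scope ring_scope.

(**
Work in the upper half-plane with its hyperbolic metric.  With [L = |zeta|^2]
and [w] replaced by [s = w + Re zeta / L], the integrand is the difference at
the boundary point [s] of the Busemann functions (logarithms of the Poisson
kernel) of [z_Q = Q + i a], which lies on the horocycle of height
[a = Im zeta / L], and of a translate [p = c + i b] of [zeta], where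
[b = Im zeta] and [c = (1 + 1/L) Re zeta].  Busemann functions are convex, so
if [p] is the Cartan barycenter of the law of [z_Q], i.e. the minimiser of the
mean of [dist^2 / 2], the expectation is nonnegative; it vanishes only if all
[z_Q] lie on a single geodesic ending at [s], and a geodesic meets a horocycle
in at most two points.  Uniformity in [s] follows from continuity and from the
limit [ln L > 0] at infinity.

For each [a > 0] the barycenter exists and, by the CAT(0) inequality, is
unique and continuous in [a].  The points [z_Q] and [p] come from some [zeta]
exactly when [a b ((a + b)^2 + c^2) = (a + b)^2].  The left-hand side is larger
at [a = 1], where [b > a], and smaller as [a] tends to [0], because [b / a]
then tends to infinity; so the equation is solved by the intermediate value
theorem.
*)

(** * Hyperbolic functions *)

Section Hyperbolic.
Context {R : realType}.
Implicit Types x y s D G A : R.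

Definition cosh x : R := (expR x + expR (- x)) / 2.
Definition sinh x : R := (expR x - expR (- x)) / 2.

Lemma cosh_sq x : cosh x ^+ 2 = 1 + sinh x ^+ 2.
Proof. by rewrite /cosh /sinh; have := expRxMexpNx_1 x; nra. Qed.

Lemma coshD x y : cosh (x + y) = cosh x * cosh y + sinh x * sinh y.
Proof. by rewrite /cosh /sinh opprD !expRD; field. Qed.

Lemma sinhD x y : sinh (x + y) = sinh x * cosh y + cosh x * sinh y.
Proof. by rewrite /cosh /sinh opprD !expRD; field. Qed.

Lemma coshN x : cosh (- x) = cosh x.
Proof. by rewrite /cosh opprK addrC. Qed.

Lemma sinhN x : sinh (- x) = - sinh x.
Proof. by rewrite /sinh opprK -mulNr opprB. Qed.

Lemma sinh0 : sinh 0 = 0.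
Proof. by rewrite /sinh oppr0 subrr mul0r. Qed.

Lemma sinh_ge0 x : 0 <= x -> 0 <= sinh x.
Proof. by move=> x0; rewrite divr_ge0// subr_ge0 ler_expR; lra. Qed.

Lemma cosh_ge1 x : 1 <= cosh x.
Proof.
rewrite /cosh expRN; have := expR_gt0 x; set e := expR x => e0.
rewrite -subr_ge0 (_ : _ - 1 = (e - 1) ^+ 2 / (2 * e)); last by field; lra.
by rewrite divr_ge0 ?sqr_ge0//; lra.
Qed.

Global Instance is_derive_sinh x : is_derive x 1 sinh (cosh x).
Proof.
rewrite /sinh /cosh; apply: is_derive_eq.
by rewrite /= /GRing.scale/= ; field.
Qed.

Global Instance is_derive_cosh x : is_derive x 1 cosh (sinh x).
Proof.
rewrite /sinh /cosh; apply: is_derive_eq.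
by rewrite /= /GRing.scale/= ; field.
Qed.

Lemma ge0_derive_ge0 (f df : R -> R) x :
  (forall y, is_derive y 1 f (df y)) -> (forall y, 0 <= y -> 0 <= df y) ->
  f 0 = 0 -> 0 <= x -> 0 <= f x.
Proof.
move=> fd df0 f0; rewrite le_eqVlt => /predU1P[<-|x0]; first by rewrite f0.
have [|c /itvP cx] := @MVT R f df 0 x x0 (fun y _ => fd y).
  by apply: derivable_within_continuous => y _; have [] := fd y.
by rewrite f0 !subr0 => ->; rewrite mulr_ge0// ?df0 ?cx// ltW.
Qed.

Lemma sinh_ge x : 0 <= x -> x <= sinh x.
Proof.
move=> x0; rewrite -subr_ge0.
apply: (@ge0_derive_ge0 (sinh - id) (fun y => cosh y - 1)) => // [y _|].
  by rewrite subr_ge0 cosh_ge1.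
by rewrite /= !fctE sinh0 subrr.
Qed.

Lemma sinh_le x : 0 <= x -> sinh x <= x * cosh x.
Proof.
move=> x0; rewrite -subr_ge0.
apply: (@ge0_derive_ge0 (id * cosh - sinh) (fun y => y * sinh y)) => // [y|y y0|].
- by apply: is_derive_eq; rewrite /= /GRing.scale/=; ring.
- by rewrite mulr_ge0// sinh_ge0.
- by rewrite /= !fctE sinh0 mul0r subrr.
Qed.

(** For positive arguments, dividing by [x * y * sinh x * sinh y] turns this into
    [1/x + 1/y <= coth x + coth y], the sum of two instances of [sinh_le]. *)
Lemma sinhD_ge x y : 0 <= x -> 0 <= y ->
  (x + y) * (sinh x * sinh y) <= x * y * sinh (x + y).
Proof.
move=> x0 y0; rewrite sinhD -subr_ge0.
have -> : x * y * (sinh x * cosh y + cosh x * sinh y) -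
   (x + y) * (sinh x * sinh y) =
   x * sinh x * (y * cosh y - sinh y) + y * sinh y * (x * cosh x - sinh x).
  by ring.
by rewrite addr_ge0// mulr_ge0 ?subr_ge0 ?sinh_le// mulr_ge0// sinh_ge0.
Qed.

Lemma sqr_le_cosh x : x ^+ 2 <= 2 * (cosh x - 1).
Proof.
wlog x0 : x / 0 <= x.
  by move=> H; case: (leP 0 x) => [/H//|?]; rewrite -sqrrN -coshN H//; lra.
have -> : 2 * (cosh x - 1) = 4 * sinh (x / 2) ^+ 2.
  have -> : x = x / 2 + x / 2 by field.
  rewrite coshD -!expr2 cosh_sq; have -> : (x / 2 + x / 2) / 2 = x / 2 by field.
  by ring.
have : x / 2 <= sinh (x / 2) by rewrite sinh_ge//; lra.
by nra.
Qed.

(* As a function of [cosh x], [x ^+ 2] is concave: this is its tangent at [y]. *)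
Lemma sqr_sub_le_cosh x y : 0 <= x -> 0 <= y ->
  sinh y * (x ^+ 2 - y ^+ 2) <= 2 * y * (cosh x - cosh y).
Proof.
(* With half sum [s] and half difference [e] the claim becomes
   [s * e * sinh y <= y * sinh s * sinh e]. Then [sinhD_ge] applies to [s = y + e] if [e > 0] and to
   [y = s + (- e)] if [e < 0]. *)
move=> x0 y0; pose s := (x + y) / 2; pose e := (x - y) / 2.
have -> : x = s + e by rewrite /s /e; field.
have yE : y = s - e by rewrite /s /e; field.
have -> : cosh (s + e) - cosh y = 2 * (sinh s * sinh e).
  by rewrite yE !coshD coshN sinhN; ring.
have -> : (s + e) ^+ 2 - y ^+ 2 = 4 * (s * e) by rewrite yE; ring.
have s0 : 0 <= s by rewrite /s; lra.
have [e0|e0|e0] := ltgtP 0 e; last by rewrite -e0 sinh0; lra.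
- have := sinhD_ge y0 (ltW e0); have -> : y + e = s by rewrite yE; ring.
  have sh : s * (sinh y * e) <= s * (sinh y * sinh e).
    by rewrite !ler_wpM2l ?sinh_ge0 ?sinh_ge// ltW.
  move=> h; have : sinh y * s <= y * sinh s by rewrite -(ler_pM2r e0); nra.
  have := @sinh_ge e (ltW e0); have := sinh_ge0 s0; nra.
- have e0' : 0 <= - e by lra.
  have := sinhD_ge s0 e0'; have -> : s + - e = y by rewrite yE.
  by rewrite sinhN; nra.
Qed.

(** * The squared distance as a function of its hyperbolic cosine *)

Definition arcosh D : R := ln (D + Num.sqrt (D ^+ 2 - 1)).

Lemma arcosh_ge0 D : 1 <= D -> 0 <= arcosh D.
Proof. by move=> D1; rewrite ln_ge0// ler_wpDr// sqrtr_ge0. Qed.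

Lemma expR_arcosh D : 1 <= D -> expR (arcosh D) = D + Num.sqrt (D ^+ 2 - 1).
Proof. by move=> D1; rewrite lnK// posrE ltr_wpDr ?sqrtr_ge0//; lra. Qed.

Lemma expRN_arcosh D : 1 <= D -> expR (- arcosh D) = D - Num.sqrt (D ^+ 2 - 1).
Proof.
move=> D1; rewrite expRN expR_arcosh//.
have : 0 <= Num.sqrt (D ^+ 2 - 1) by rewrite sqrtr_ge0.
have : Num.sqrt (D ^+ 2 - 1) ^+ 2 = D ^+ 2 - 1 by rewrite sqr_sqrtr; nra.
set q := Num.sqrt _ => qE q0.
apply: (@mulIf _ (D + q)); first by apply/eqP; lra.
by rewrite mulVf; [nra | apply/eqP; lra].
Qed.

Lemma cosh_arcosh D : 1 <= D -> cosh (arcosh D) = D.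
Proof. by move=> D1; rewrite /cosh expR_arcosh// expRN_arcosh//; field. Qed.

Lemma sinh_arcosh D : 1 <= D -> sinh (arcosh D) = Num.sqrt (D ^+ 2 - 1).
Proof. by move=> D1; rewrite /sinh expR_arcosh// expRN_arcosh//; field. Qed.

Lemma arcosh1 : arcosh 1 = 0.
Proof. by rewrite /arcosh expr1n subrr sqrtr0 addr0 ln1. Qed.

Lemma ln_le_arcosh D : 1 <= D -> ln D <= arcosh D.
Proof.
move=> D1; rewrite ler_ln ?posrE ?lerDl ?sqrtr_ge0//; first by lra.
by rewrite ltr_wpDr ?sqrtr_ge0//; lra.
Qed.

(** Half the squared distance, in terms of the hyperbolic cosine [D] of the distance; in this
    variable it is concave. *)
Definition psi D : R := arcosh D ^+ 2 / 2.

(* The derivative [rho / sinh rho] of [psi] at [D = cosh rho], extended by its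
   limit [1] at [D = 1]. *)
Definition dpsi D : R := if D == 1 then 1 else arcosh D / Num.sqrt (D ^+ 2 - 1).

Lemma dpsi_sinh D : 1 <= D -> dpsi D * Num.sqrt (D ^+ 2 - 1) = arcosh D.
Proof.
move=> D1; rewrite /dpsi; case: eqP => [->|/eqP D1'].
  by rewrite expr1n subrr sqrtr0 mulr0 arcosh1.
rewrite divfK// sqrtr_eq0 -ltNge; have : 1 < D by rewrite lt_neqAle eq_sym D1'.
by nra.
Qed.

Lemma sqrtB1_gt0 D : 1 < D -> 0 < Num.sqrt (D ^+ 2 - 1).
Proof. by move=> D1; rewrite sqrtr_gt0; nra. Qed.

Lemma dpsi_gt0 D : 1 <= D -> 0 < dpsi D.
Proof.
move=> D1; rewrite /dpsi; case: eqP => // /eqP D1'.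
have {D1'}D1 : 1 < D by rewrite lt_neqAle eq_sym D1'.
by rewrite divr_gt0 ?sqrtB1_gt0// ln_gt0//; have := sqrtB1_gt0 D1; lra.
Qed.

Lemma dpsi_le1 D : 1 <= D -> dpsi D <= 1.
Proof.
move=> D1; rewrite /dpsi; case: eqP => // /eqP D1'.
have {}D1' : 1 < D by rewrite lt_neqAle eq_sym D1'.
by rewrite ler_pdivrMr ?sqrtB1_gt0// mul1r -sinh_arcosh// sinh_ge// arcosh_ge0.
Qed.

Lemma psi1 : psi 1 = 0.
Proof. by rewrite /psi arcosh1 expr0n mul0r. Qed.

(** Concavity of [psi], read at the point [cosh s]. The sign of [s] is left free so that a
    difference of two lengths can be inserted. *)
Lemma psi_tangent_cosh D s : 1 <= D -> s ^+ 2 / 2 <= psi D + dpsi D * (cosh s - D).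
Proof.
wlog s0 : s / 0 <= s.
  move=> H; case: (leP 0 s) => [/H//|?] D1.
  by rewrite -sqrrN -coshN H//; lra.
move=> D1; rewrite /psi; have := dpsi_sinh D1; rewrite /dpsi; case: eqP => [->|/eqP D1' _].
  by have := sqr_le_cosh s; rewrite arcosh1; lra.
have {}D1' : 1 < D by rewrite lt_neqAle eq_sym D1'.
have := sqr_sub_le_cosh s0 (arcosh_ge0 D1); rewrite sinh_arcosh// cosh_arcosh//.
have := sqrtB1_gt0 D1'; set q := Num.sqrt _ => q0 h.
rewrite -subr_ge0 mulrAC -(pmulr_rge0 _ q0).
rewrite (_ : q * _ = (q * arcosh D ^+ 2 / 2 + arcosh D * (cosh s - D)) - q * (s ^+ 2 / 2)).
  by lra.
by field; rewrite gt_eqF.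
Qed.

Lemma psi_tangent D D' : 1 <= D -> 1 <= D' -> psi D' <= psi D + dpsi D * (D' - D).
Proof.
by move=> D1 D1'; have := psi_tangent_cosh (arcosh D') D1; rewrite cosh_arcosh.
Qed.

Lemma psi_ge0 D : 0 <= psi D.
Proof. by rewrite /psi divr_ge0// sqr_ge0. Qed.

Lemma psi_le D D' : 1 <= D -> D <= D' -> psi D <= psi D'.
Proof.
move=> D1 DD'; have D1' := le_trans D1 DD'.
by have := psi_tangent D1' D1; have := dpsi_gt0 D1'; nra.
Qed.

Lemma psi_lip D D' : 1 <= D -> 1 <= D' -> `|psi D' - psi D| <= `|D' - D|.
Proof.
wlog DD' : D D' / D <= D'.
  move=> H D1 D1'; case: (leP D D') => [/H->//|/ltW DD'].
  by rewrite distrC (distrC D') H.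
move=> D1 D1'; rewrite !ger0_norm ?subr_ge0 ?psi_le//.
have := psi_tangent D1 D1'; have := dpsi_le1 D1; have := dpsi_gt0 D1; nra.
Qed.

(* The CAT(0) inequality for a triangle with sides [arcosh D], [arcosh D'] and
   [arcosh G], the last term of the left-hand side being the inner product of
   the first two sides by the cosine law. *)
Lemma psi_cat0 D D' G : 1 <= D -> 1 <= D' -> 1 <= G ->
  (D * D' - G) ^+ 2 <= (D ^+ 2 - 1) * (D' ^+ 2 - 1) ->
  psi D + psi D' - dpsi D * dpsi D' * (D * D' - G) <= psi G.
Proof.
move=> D1 D1' G1 DG.
have [E|E] := eqVneq D 1.
  have -> : G = D' by rewrite E in DG; nra.
  by rewrite E psi1; lra.
have [E'|E'] := eqVneq D' 1.
  have -> : G = D by rewrite E' in DG; nra.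
  by rewrite E' psi1; lra.
have q0 : 0 < Num.sqrt (D ^+ 2 - 1) by rewrite sqrtB1_gt0// lt_neqAle eq_sym E.
have q0' : 0 < Num.sqrt (D' ^+ 2 - 1) by rewrite sqrtB1_gt0// lt_neqAle eq_sym E'.
have qE : Num.sqrt (D ^+ 2 - 1) ^+ 2 = D ^+ 2 - 1 by rewrite sqr_sqrtr; nra.
have qE' : Num.sqrt (D' ^+ 2 - 1) ^+ 2 = D' ^+ 2 - 1 by rewrite sqr_sqrtr; nra.
have kE := dpsi_sinh D1; have kE' := dpsi_sinh D1'.
have sE := sinh_arcosh D1; have sE' := sinh_arcosh D1'.
have cE := cosh_arcosh D1; have cE' := cosh_arcosh D1'.
rewrite /psi; move: qE qE' q0 q0' kE kE' sE sE' cE cE' DG.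
set q := Num.sqrt _; set q' := Num.sqrt (D' ^+ 2 - 1).
set a := arcosh D; set b := arcosh D' => qE qE' q0 q0' kE kE' sE sE' cE cE' DG.
(* By the cosine law [s] is the cosine of the angle between the first two sides. Hence [G] is the
   average of [cosh (a - b)] and [cosh (a + b)] with weights [(1 + s) / 2] and [(1 - s) / 2], and
   the concavity of [psi] at [G] applies. *)
pose s := (D * D' - G) / (q * q').
have GE : G = D * D' - s * q * q' by rewrite /s; field; rewrite !gt_eqF.
have s1 : s ^+ 2 <= 1.
  rewrite /s exprMn exprVn ler_pdivrMr ?exprn_gt0 ?mulr_gt0// mul1r exprMn qE qE'.
  exact: DG.
have {s1} s1 : -1 <= s <= 1 by rewrite -ler_norml -(expr_le1 (ltn0Sn 1))// real_normK ?num_real.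
have h1 := psi_tangent_cosh (a - b) G1; have h2 := psi_tangent_cosh (a + b) G1.
move: h1 h2; rewrite !coshD coshN sinhN sE sE' cE cE' => h1 h2.
have {}h1 : (1 + s) / 2 * ((a - b) ^+ 2 / 2) <= _ := ler_wpM2l _ h1.
have {}h2 : (1 - s) / 2 * ((a + b) ^+ 2 / 2) <= _ := ler_wpM2l _ h2.
have := lerD (h1 _) (h2 _); rewrite -/(psi G).
have -> : (1 + s) / 2 * ((a - b) ^+ 2 / 2) + (1 - s) / 2 * ((a + b) ^+ 2 / 2) =
  a ^+ 2 / 2 + b ^+ 2 / 2 - dpsi D * dpsi D' * (D * D' - G).
  by rewrite GE -kE -kE'; field.
move=> h; have [s1l s1r] := andP s1.
apply: le_trans (h _ _) _; [by clear -s1l s1r; lra..|].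
by rewrite /psi GE le_eqVlt; apply/orP; left; apply/eqP; field.
Qed.

(* [k (A - D)] is the chord of [ln] between [expR (- rho)] and [expR rho],
   where [D = cosh rho]. *)
Lemma dpsi_chord_lt_ln D A : 1 <= D -> 0 < A -> A ^+ 2 + 1 < 2 * D * A ->
  dpsi D * (A - D) < ln A.
Proof.
move=> D1 A0 AD.
have {D1}D1' : 1 < D.
  by rewrite lt_neqAle D1 andbT; apply: contraTneq AD => <-; rewrite -leNgt;
  have := sqr_ge0 (A - 1); lra.
have D1 := ltW D1'; have := sqrtB1_gt0 D1'; have := dpsi_sinh D1.
have := expR_arcosh D1; have := expRN_arcosh D1.
have : Num.sqrt (D ^+ 2 - 1) ^+ 2 = D ^+ 2 - 1 by rewrite sqr_sqrtr; nra.
set q := Num.sqrt _; set a := arcosh D => qE eNE eE kE q0.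
(* The hypothesis says [(A - D) ^+ 2 < D ^+ 2 - 1]: [A] lies strictly between the ends of the
   chord. *)
have Aq : - q < A - D < q.
  by rewrite -ltr_norml -ltr_sqr ?nnegrE ?(ltW q0)// real_normK ?num_real// qE; lra.
pose s := (A - D) / q.
have sE : A = D + s * q by rewrite /s divfK ?gt_eqF//; lra.
have s1 : - 1 < s < 1 by rewrite /s ltr_pdivlMr// ltr_pdivrMr// mulN1r mul1r.
(* The tangent of [ln] at [A] is strictly above [ln] elsewhere. Averaging this over the two ends,
   with weights whose barycenter is [A], cancels the linear terms. *)
have ln_lt x : expR x != A -> x < ln A + (expR x / A - 1).
  move=> xA; have e0 : 0 < expR x / A by rewrite divr_gt0 ?expR_gt0.
  have e1 : ln (expR x / A) != 0.
    rewrite ln_eq0//; apply: contraNneq xA => h.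
    by rewrite -(divfK (lt0r_neq0 A0) (expR x)) h mul1r.
  have := expR_gt1Dx e1; rewrite lnK ?posrE// ln_div ?posrE ?expR_gt0// expRK; lra.
have h1 : a < ln A + (expR a / A - 1) by apply: ln_lt; rewrite eE sE gt_eqF//; nra.
have h2 : - a < ln A + (expR (- a) / A - 1).
  by apply: ln_lt; rewrite eNE sE lt_eqF//; nra.
have : (1 + s) / 2 * a + (1 - s) / 2 * - a <
  (1 + s) / 2 * (ln A + (expR a / A - 1)) +
  (1 - s) / 2 * (ln A + (expR (- a) / A - 1)).
  by rewrite ltrD// ltr_pM2l//; lra.
rewrite eE eNE -kE (_ : A - D = s * q); last by rewrite sE; ring.
have -> : (1 + s) / 2 * (ln A + ((D + q) / A - 1)) +
  (1 - s) / 2 * (ln A + ((D - q) / A - 1)) = ln A + ((D + s * q) / A - 1) by field; lra.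
by rewrite -sE divff ?gt_eqF// subrr addr0; nra.
Qed.

(** In the case of equality [A] is an end of the chord, where the chord meets [ln]. *)
Lemma dpsi_chord_le_ln D A : 1 <= D -> 0 < A -> A ^+ 2 + 1 <= 2 * D * A ->
  dpsi D * (A - D) <= ln A.
Proof.
move=> D1 A0; rewrite le_eqVlt => /predU1P[AD|]; last first.
  by move=> /(dpsi_chord_lt_ln D1 A0)/ltW.
have qE : Num.sqrt (D ^+ 2 - 1) = `|A - D|.
  by rewrite -sqrtr_sqr; congr Num.sqrt; nra.
have := dpsi_sinh D1; rewrite qE /arcosh qE.
have [AD1 h|AD1 h] := leP 0 (A - D).
  by move: h; rewrite ger0_norm// => ->; rewrite addrC subrK.
have -> : ln A = - ln (D + `|A - D|).
  rewrite -lnV ?posrE; last by rewrite ltr_wpDr//; lra.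
  congr ln; rewrite ltr0_norm//; apply: (@mulIf _ (D + - (A - D))); first by apply/eqP; lra.
  by rewrite mulVf; [nra | apply/eqP; lra].
by rewrite -h ltr0_norm//; lra.
Qed.

End Hyperbolic.

(** * Means of bounded functions *)

Section Expectation.
Context {R : realType} {d : measure_display} {T : measurableType d}.
Variables (P : probability T R) (X : T -> R) (M : R).
Hypothesis mX : measurable_fun [set: T] X.
Hypothesis X_le : forall t, `|X t| <= M.
Implicit Types g h : R -> R.

(* [X] takes its values in [[-M, M]], so only those matter for integrability. *)
Definition mbounded g := measurable_fun [set: R] g /\
  exists C : R, forall q, `|q| <= M -> `|g q| <= C.

Definition mean g : R := (\int[P]_t g (X t))%R.

Lemma mbounded_cst c : mbounded (fun=> c).
Proof. by split; [exact: measurable_cst | exists `|c|]. Qed.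

Lemma mbounded_id : mbounded (fun q => q).
Proof. by split; [exact: measurable_id | exists M]. Qed.

Lemma mboundedD g h : mbounded g -> mbounded h -> mbounded (fun q => g q + h q).
Proof.
move=> [mg [C gC]] [mh [C' hC]]; split; first exact: measurable_funD.
by exists (C + C') => q qM; rewrite (le_trans (ler_normD _ _))// lerD ?gC ?hC.
Qed.

Lemma mboundedN g : mbounded g -> mbounded (fun q => - g q).
Proof.
move=> [mg [C gC]]; split; first exact: measurable_funN.
by exists C => q qM; rewrite normrN gC.
Qed.

Lemma mboundedB g h : mbounded g -> mbounded h -> mbounded (fun q => g q - h q).
Proof. by move=> ag ah; apply: mboundedD => //; exact: mboundedN. Qed.

Lemma mboundedM g h : mbounded g -> mbounded h -> mbounded (fun q => g q * h q).
Proof.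
move=> [mg [C gC]] [mh [C' hC]]; split; first exact: measurable_funM.
by exists (C * C') => q qM; rewrite normrM ler_pM ?gC ?hC.
Qed.

Lemma mboundedX g n : mbounded g -> mbounded (fun q => g q ^+ n).
Proof.
move=> [mg [C gC]]; split; first exact: measurable_funX.
by exists (C ^+ n) => q qM; rewrite normrX lerXn2r ?nnegrE ?gC// (le_trans _ (gC q qM)).
Qed.

Lemma mbounded_le g h : measurable_fun [set: R] g -> mbounded h ->
  (forall q, `|q| <= M -> `|g q| <= h q) -> mbounded g.
Proof.
move=> mg [mh [C hC]] gh; split=> //; exists C => q qM.
by rewrite (le_trans (gh _ qM))// (le_trans (ler_norm _))// hC.
Qed.

Lemma mbounded_integrable g : mbounded g -> P.-integrable [set: T] (EFin \o (fun t => g (X t))).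
Proof.
move=> [mg [C gC]]; apply: measurable_bounded_integrable => //.
- by rewrite [X in (X < _)%E](probability_setT P) ltry.
- exact: measurableT_comp.
- exists C; split; first exact: num_real.
  by move=> x Cx t _ /=; rewrite (le_trans (gC _ (X_le t)))// ltW.
Qed.

Lemma mean_cst c : mean (fun=> c) = c.
Proof. by rewrite /mean Rintegral_cst// [X in fine X](probability_setT P) mulr1. Qed.

Lemma meanD g h : mbounded g -> mbounded h -> mean (fun q => g q + h q) = mean g + mean h.
Proof. by move=> ag ah; rewrite /mean RintegralD//; exact: mbounded_integrable. Qed.

Lemma meanB g h : mbounded g -> mbounded h -> mean (fun q => g q - h q) = mean g - mean h.
Proof. by move=> ag ah; rewrite /mean RintegralB//; exact: mbounded_integrable. Qed.

Lemma meanZ c g : mbounded g -> mean (fun q => c * g q) = c * mean g.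
Proof. by move=> ag; rewrite /mean RintegralZl//; exact: mbounded_integrable. Qed.

Lemma mean_le g h : mbounded g -> mbounded h ->
  (forall q, `|q| <= M -> g q <= h q) -> mean g <= mean h.
Proof.
move=> ag ah gh; apply: le_Rintegral => //; [exact: mbounded_integrable..|].
by move=> t _; exact: gh.
Qed.

Lemma eq_mean g h : (forall q, `|q| <= M -> g q = h q) -> mean g = mean h.
Proof. by move=> gh; apply: eq_Rintegral => t _; exact: gh. Qed.

Lemma mean_ge0 g : (forall q, `|q| <= M -> 0 <= g q) -> 0 <= mean g.
Proof. by move=> g0; apply: Rintegral_ge0 => t _; exact: g0. Qed.

Lemma le_norm_mean g c : mbounded g -> (forall q, `|q| <= M -> `|g q| <= c) -> `|mean g| <= c.
Proof.
move=> ag gc; rewrite ler_norml -(mean_cst (- c)) -[X in _ && (_ <= X)](mean_cst c).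
by rewrite !mean_le//; try exact: mbounded_cst; move=> q /gc; rewrite ler_norml => /andP[].
Qed.

(** If the mean were zero, [g (X t)] would vanish almost everywhere, so [X] would lie in [A] almost
    surely. *)
Lemma mean_gt0 g (A : set R) : mbounded g -> (forall q, `|q| <= M -> 0 <= g q) ->
  (forall q, `|q| <= M -> ~ A q -> 0 < g q) -> measurable A ->
  P (X @^-1` A) != 1%E -> 0 < mean g.
Proof.
move=> ag g0 gA mA PA; rewrite lt_neqAle mean_ge0// andbT eq_sym.
apply: contraNneq PA => E0.
have iE : (\int[P]_t `|(g (X t))%:E| = 0)%E.
  transitivity (mean g)%:E; last by rewrite E0.
  rewrite /mean /Rintegral fineK ?integrable_fin_num//; last exact: mbounded_integrable.
  by apply: eq_integral => t _; rewrite gee0_abs// lee_fin g0.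
have /ae_eq_integral_abs : measurable_fun [set: T] (fun t => (g (X t))%:E).
  by apply/measurable_EFinP; apply: measurableT_comp => //; exact: ag.1.
move=> /(_ P measurableT) [/(_ iE)[N [mN PN0 sN]] _].
have mXA : measurable (X @^-1` A) by rewrite -[X in measurable X]setTI; exact: mX.
rewrite eq_le probability_le1//=.
have PT : (1 = P [set: T])%E by rewrite [RHS](probability_setT P).
rewrite PT -(setvU (X @^-1` A)) setUC.
rewrite measureU//; [|exact: measurableC|exact: setICr].
rewrite [X in (_ + X <= _)%E](_ : _ = 0%E) ?adde0//.
apply/eqP; rewrite eq_le measure_ge0 andbT -PN0 le_measure ?inE//; first exact: measurableC.
apply: subset_trans sN => t /= nA /(_ I) [gt0].
by have := gA _ (X_le t) nA; rewrite gt0 ltxx.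
Qed.

End Expectation.

(** * Measurability of the functions of the distance *)

Section MeasurablePsi.
Context {R : realType}.

Lemma measurable_sqrt : measurable_fun [set: R] (@Num.sqrt R).
Proof. by apply: continuous_measurable_fun; exact: sqrt_continuous. Qed.

Lemma measurable_inv : measurable_fun [set: R] (@GRing.inv R).
Proof.
(* A measurable power function replaces the inverse; at [0] both sides take the default value
   [0]. *)
rewrite (_ : GRing.inv = fun x => x * (x ^+ 2) `^ (-1)); last first.
  apply/funext => x; rewrite powR_inv1 ?sqr_ge0//.
  have [->|x0] := eqVneq x 0; first by rewrite invr0 mul0r.
  by field.
apply: measurable_funM => //.
exact: (measurableT_comp (measurable_powR (- 1)) (measurable_funX 2 (@measurable_id _ _ _))).
Qed.

Lemma measurable_arcosh : measurable_fun [set: R] (@arcosh R).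
Proof.
apply: measurableT_comp; first exact: measurable_ln.
apply: measurable_funD => //; apply: measurableT_comp; first exact: measurable_sqrt.
by apply: measurable_funB => //; exact: measurable_funX.
Qed.

Lemma measurable_psi : measurable_fun [set: R] (@psi R).
Proof. by apply: measurable_funM => //; exact: measurable_funX measurable_arcosh. Qed.

Lemma measurable_dpsi : measurable_fun [set: R] (@dpsi R).
Proof.
apply: measurable_fun_ifT => //; first exact: measurable_fun_eqr.
apply: measurable_funM; first exact: measurable_arcosh.
apply: measurableT_comp; first exact: measurable_inv.
apply: measurableT_comp; first exact: measurable_sqrt.
by apply: measurable_funB => //; exact: measurable_funX.
Qed.

End MeasurablePsi.

(** * Half-plane geometry *)

(** The case [n = 0] is Lipschitz continuity; [n = 1] serves functions whose squared increments are
    controlled linearly. *)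
Lemma holder_within_continuous {R : realType} (V : normedModType R) (A : set V)
    (f : V -> R) n K :
  (forall x y, A x -> A y -> `|f x - f y| ^+ n.+1 <= K * `|x - y|) ->
  {within A, continuous f}.
Proof.
move=> fK; apply/subspace_continuousP => x Ax; apply/cvgrPdist_le => e e0.
have d0 : 0 < e ^+ n.+1 / (`|K| + 1) by rewrite divr_gt0 ?exprn_gt0// ltr_wpDl.
have dx : \forall y \near x, `|x - y| <= e ^+ n.+1 / (`|K| + 1).
  by apply: (@cvgr_dist_le _ _ _ (nbhs x) _ id x) => //; exact: cvg_id.
near=> y; have Ay : A y by near: y; exact: withinT.
rewrite -(@ler_pXn2r _ n.+1) ?nnegrE ?(ltW e0)//.
apply: le_trans (fK _ _ Ax Ay) _.
have : `|x - y| <= e ^+ n.+1 / (`|K| + 1).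
  by near: y; rewrite near_withinE; apply: filterS dx.
rewrite ler_pdivlMr ?ltr_wpDl// => h; apply: le_trans h; rewrite mulrC ler_wpM2l//.
by rewrite (le_trans (ler_norm _))// lerDl.
Unshelve. all: by end_near. Qed.

Section HalfPlane.
Context {R : realType}.
Implicit Types x y c b q a s : R.

(* The hyperbolic cosine of the distance between the points [x1 + i y1] and
   [x2 + i y2] of the upper half-plane. *)
Definition hcosh x1 y1 x2 y2 : R :=
  ((x1 - x2) ^+ 2 + y1 ^+ 2 + y2 ^+ 2) / (2 * y1 * y2).

Lemma hcoshC x1 y1 x2 y2 : hcosh x1 y1 x2 y2 = hcosh x2 y2 x1 y1.
Proof.
by rewrite /hcosh -sqrrN opprB addrAC (mulrAC 2 y1).
Qed.

Lemma hcoshE x1 y1 x2 y2 : 0 < y1 -> 0 < y2 ->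
  hcosh x1 y1 x2 y2 = 1 + ((x1 - x2) ^+ 2 + (y1 - y2) ^+ 2) / (2 * y1 * y2).
Proof. by move=> h1 h2; rewrite /hcosh; field; rewrite !gt_eqF. Qed.

Lemma hcosh_ge1 x1 y1 x2 y2 : 0 < y1 -> 0 < y2 -> 1 <= hcosh x1 y1 x2 y2.
Proof.
move=> h1 h2; rewrite hcoshE// lerDl divr_ge0 ?addr_ge0 ?sqr_ge0//.
by rewrite ltW// !mulr_gt0.
Qed.

(** The cosine of the angle at [c + i b] has square at most [1]. The difference of the two sides is
    the square of [e], which up to sign is the product of the two hyperbolic sines and the sine of
    that angle. *)
Lemma hcosh_cat0 q a c b c' b' : 0 < a -> 0 < b -> 0 < b' ->
  (hcosh q a c b * hcosh c b c' b' - hcosh q a c' b') ^+ 2 <=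
  (hcosh q a c b ^+ 2 - 1) * (hcosh c b c' b' ^+ 2 - 1).
Proof.
move=> a0 b0 b0'; rewrite -subr_ge0.
pose e := ((q - c) * (c' - c) ^+ 2 + (q - c) * (b' ^+ 2 - b ^+ 2)
  - (c' - c) * (q - c) ^+ 2 - (c' - c) * (a ^+ 2 - b ^+ 2)) / (2 * a * b * b').
rewrite (_ : _ - _ = e ^+ 2) ?sqr_ge0// /e /hcosh.
by field; rewrite !gt_eqF.
Qed.

Lemma hcosh_lip l N : 0 < l -> exists2 K, 0 <= K & forall q a c b c' b',
  `|q| <= N -> `|c| <= N -> `|c'| <= N ->
  l <= a <= N -> l <= b <= N -> l <= b' <= N ->
  `|hcosh q a c b - hcosh q a c' b'| <= K * (`|c - c'| + `|b - b'|).
Proof.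
move=> l0; pose K := `|4 * N / l ^+ 2| + `|5 * N ^+ 2 / l ^+ 3| + `|l^-1|.
exists K => [|q a c b c' b']; first by rewrite !addr_ge0.
move=> /ler_normlP[q1 q2] /ler_normlP[c1 c2] /ler_normlP[c1' c2'].
move=> /andP[a1 a2] /andP[b1 b2] /andP[b1' b2'].
have [a0 b0 b0'] : [/\ 0 < a, 0 < b & 0 < b'] by split; lra.
(* The second point moves first horizontally, with slope [u], then vertically, with slope [v]; the
   first term of [K] bounds [u], the other two bound [v]. *)
pose u := (2 * q - c - c') / (2 * a * b).
pose v := (2 * a)^-1 - ((q - c') ^+ 2 + a ^+ 2) / (2 * a * b * b').
have -> : hcosh q a c b - hcosh q a c' b' = u * (c' - c) + v * (b - b').
  by rewrite /u /v /hcosh; field; rewrite !gt_eqF.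
have N0 : 0 < N by lra.
rewrite (le_trans (ler_normD _ _))// !normrM (distrC c') mulrDr.
have K1 : `|4 * N / l ^+ 2| = 4 * N / l ^+ 2.
  by rewrite ger0_norm// divr_ge0 ?exprn_ge0 ?(ltW l0)//; lra.
have K2 : `|5 * N ^+ 2 / l ^+ 3| = 5 * N ^+ 2 / l ^+ 3.
  by rewrite ger0_norm// divr_ge0 ?exprn_ge0 ?(ltW l0)// mulr_ge0// sqr_ge0.
have K3 : `|l^-1| = l^-1 by rewrite ger0_norm// invr_ge0 ltW.
have K1' : 0 <= 4 * N / l ^+ 2 by rewrite -K1.
have K2' : 0 <= 5 * N ^+ 2 / l ^+ 3 by rewrite -K2.
have K3' : 0 <= l^-1 by rewrite -K3.
have lab : l ^+ 2 <= 2 * a * b by nra.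
have labb : l ^+ 3 <= 2 * a * b * b' by rewrite exprSr ler_pM// ?exprn_ge0// ltW.
apply: lerD; rewrite ler_wpM2r// /K K1 K2 K3.
  rewrite (@le_trans _ _ (4 * N / l ^+ 2))//; last by lra.
  rewrite ler_pM// ?normfV.
    by rewrite ler_norml; apply/andP; split; lra.
  rewrite ger0_norm; last by rewrite ltW// !mulr_gt0.
  by rewrite lef_pV2 ?posrE ?exprn_gt0// !mulr_gt0.
rewrite /v (le_trans (ler_normB _ _))//.
rewrite (@le_trans _ _ (l^-1 + 5 * N ^+ 2 / l ^+ 3))//; last by lra.
rewrite lerD//.
  rewrite ger0_norm ?invr_ge0; last by lra.
  by rewrite lef_pV2 ?posrE//; lra.
rewrite normrM ler_pM// ?normfV.
  rewrite ger0_norm ?addr_ge0 ?sqr_ge0//.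
  have : 0 <= (2 * N - (q - c')) * (2 * N + (q - c')) by rewrite mulr_ge0//; lra.
  have : 0 <= (N - a) * (N + a) by rewrite mulr_ge0//; lra.
  lra.
rewrite ger0_norm; last by rewrite ltW// !mulr_gt0.
by rewrite lef_pV2 ?posrE ?exprn_gt0// !mulr_gt0.
Qed.

Lemma ln_tangent x y : 0 < x -> 0 < y -> ln x <= ln y + (x / y - 1).
Proof.
move=> x0 y0; rewrite -lerBlDl -ln_div ?posrE//.
have := @le_ln1Dx _ (x / y - 1); rewrite addrCA subrr addr0; apply.
by rewrite ltrBrDl subrr divr_gt0.
Qed.

Lemma ln_chord s x : 0 <= s <= 1 -> 0 <= x -> s * ln (1 + x) <= ln (1 + s * x).
Proof.
move=> /andP[s0 s1] x0; have sx : 0 < 1 + s * x by nra.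
have h1 : s * ln (1 + x) <= s * (ln (1 + s * x) + ((1 + x) / (1 + s * x) - 1)).
  by rewrite ler_wpM2l// ln_tangent//; lra.
have h2 : (1 - s) * ln 1 <= (1 - s) * (ln (1 + s * x) + (1 / (1 + s * x) - 1)).
  by rewrite ler_wpM2l ?subr_ge0// ln_tangent//; lra.
have := lerD h1 h2; rewrite ln1 mulr0 addr0 => /le_trans; apply.
rewrite le_eqVlt; apply/orP; left; apply/eqP.
by field; rewrite gt_eqF.
Qed.

(** By concavity and [psi 1 = 0], [psi] lies above its chord from [1] to [D0]. On bounded regions a
    small [psi] thus forces a small [D - 1]. *)
Lemma psi_chord (D D0 : R) : 1 <= D -> D <= D0 -> psi D0 * (D - 1) <= psi D * (D0 - 1).
Proof.
move=> D1 DD0; have D01 := le_trans D1 DD0.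
have := psi_tangent D1 (lexx 1); have := psi_tangent D1 D01; rewrite psi1.
have := dpsi_gt0 D1; nra.
Qed.

End HalfPlane.

(** * Barycenters of laws on a horocycle *)

Section Barycenter.
Context {R : realType} {d : measure_display} {T : measurableType d}.
Variables (P : probability T R) (X : T -> R) (M : R).
Hypothesis mX : measurable_fun [set: T] X.
Hypothesis X_le : forall t, `|X t| <= M.
Hypothesis M_gt0 : 0 < M.
Implicit Types a b c q : R.

Notation E := (mean P X).
Notation k a c b := (fun q => dpsi (hcosh q a c b)).

Let mb_cst := mbounded_cst M.
Let mb_id := mbounded_id M.
Let E_D := @meanD _ _ _ P X M mX X_le.
Let E_B := @meanB _ _ _ P X M mX X_le.
Let E_Z := @meanZ _ _ _ P X M mX X_le.
Let eq_E := @eq_mean _ _ _ P X M X_le.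

Lemma mbounded_hcosh a c b : mbounded M (fun q => hcosh q a c b).
Proof.
apply: mboundedM => //; do 2 (apply: mboundedD => //).
by apply: mboundedX; apply: mboundedB.
Qed.

Lemma mbounded_psi a c b : 0 < a -> 0 < b -> mbounded M (fun q => psi (hcosh q a c b)).
Proof.
move=> a0 b0; apply: (mbounded_le _ (mbounded_hcosh a c b)) => [|q _].
  exact: measurableT_comp measurable_psi (mbounded_hcosh a c b).1.
have D1 := hcosh_ge1 q c a0 b0; rewrite ger0_norm ?psi_ge0//.
by have := psi_lip (lexx 1) D1; rewrite psi1 subr0 !ger0_norm ?psi_ge0//; lra.
Qed.

Lemma mbounded_dpsi a c b : 0 < a -> 0 < b -> mbounded M (k a c b).
Proof.
move=> a0 b0; apply: (mbounded_le _ (mb_cst 1)) => [|q _].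
  exact: measurableT_comp measurable_dpsi (mbounded_hcosh a c b).1.
have D1 := hcosh_ge1 q c a0 b0.
by rewrite ger0_norm ?dpsi_le1// ltW// dpsi_gt0.
Qed.

Definition energy a c b : R := E (fun q => psi (hcosh q a c b)).

Lemma energy_lip a c b a' c' b' C : 0 < a -> 0 < b -> 0 < a' -> 0 < b' ->
  (forall q, `|q| <= M -> `|hcosh q a c b - hcosh q a' c' b'| <= C) ->
  `|energy a c b - energy a' c' b'| <= C.
Proof.
move=> a0 b0 a0' b0' HC; rewrite /energy -E_B//; [|exact: mbounded_psi..].
apply: le_norm_mean => //; first by apply: mboundedB; exact: mbounded_psi.
by move=> q /HC; apply: le_trans; apply: psi_lip; exact: hcosh_ge1.
Qed.

(** Outside a compact box the integrand is at least its value at [i a] for every [q], so a minimum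
    over the box is global. *)
Lemma energy_min a : 0 < a -> exists c b, 0 < b /\
  forall c' b', 0 < b' -> energy a c b <= energy a c' b'.
Proof.
(* [D0] bounds [hcosh q a 0 a] for [|q| <= M]. Since [hcosh q a c b] is at least [b / (2 * a)] and
   [a / (2 * b)], it exceeds [D0] for [b] outside [[b1, b2]]; for [b] inside, [|c| > C0] gives
   [|q - c| > b2], and [b2 ^+ 2 / (2 * a * b) >= D0]. *)
have M0 := M_gt0; move=> a0; pose D0 := 1 + M ^+ 2 / (2 * a ^+ 2).
have D1 : 1 <= D0 by rewrite /D0 lerDl; apply: divr_ge0;
  [exact: sqr_ge0|apply: mulr_ge0 => //; exact: sqr_ge0].
pose b1 := a / (2 * D0); have [b2 b2E] : exists b2, b2 = 2 * a * D0 by eexists.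
have [C0 C0E] : exists C0, C0 = M + b2 by eexists.
have b10 : 0 < b1 by rewrite divr_gt0//; lra.
have b1a : b1 <= a by rewrite /b1 ler_pdivrMr; nra.
have ab2 : a <= b2 by rewrite b2E; nra.
have C00 : 0 <= C0 by rewrite C0E; lra.
have far c b : 0 < b -> ~~ ((- C0 <= c <= C0) && (b1 <= b <= b2)) ->
    energy a 0 a <= energy a c b.
  move=> b0 ncb; apply: mean_le => //; [exact: mbounded_psi..|move=> q qM].
  apply: psi_le; first exact: hcosh_ge1.
  apply: (@le_trans _ _ D0).
    rewrite hcoshE// subrr subr0 expr0n addr0 /D0 lerD2l -mulrA -expr2.
    rewrite ler_wpM2r//; first by rewrite invr_ge0 mulr_ge0// sqr_ge0.
    have [q1 q2] := ler_normlP _ _ qM.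
    have : 0 <= (M - q) * (M + q) by rewrite mulr_ge0//; lra.
    lra.
  rewrite ler_pdivlMr ?mulr_gt0// (_ : D0 * _ = b2 * b); last by rewrite b2E; ring.
  have qc0 := sqr_ge0 (q - c); have [q1 q2] := ler_normlP _ _ qM.
  have [b2b|bb2] := ltP b2 b; first nra.
  have [bb1|b1b] := ltP b b1.
    have : b * (2 * D0) <= a by rewrite -ler_pdivlMr ?ltW//; lra.
    by rewrite b2E; nra.
  have : b2 * b <= b2 * b2 by rewrite ler_wpM2l//; lra.
  move: ncb; rewrite b1b bb2 !andbT negb_and -!ltNge => /orP[] cC0.
    have : 0 <= (q - c - b2) * (q - c + b2) by rewrite mulr_ge0//; rewrite C0E in cC0; lra.
    nra.
  have : 0 <= (c - q - b2) * (c - q + b2) by rewrite mulr_ge0//; rewrite C0E in cC0; lra.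
  nra.
pose A := `[- C0, C0]%classic `*` `[b1, b2]%classic.
have [|||/= p] := @compact_EVT_min _ R (fun p : R * R => energy a p.1 p.2) A.
- exists (0, a); split => /=; rewrite in_itv/=; apply/andP; split; lra.
- by apply: compact_setX; exact: segment_compact.
- have [K K0 HK] := hcosh_lip (C0 + a + b2) b10.
  (* The factor [2] appears because the norm of a pair is the maximum of the two norms. *)
  apply: (@holder_within_continuous _ _ _ _ 0 (2 * K)) => -[c b] [c' b'].
  move=> [/= + +] [/= + +]; rewrite !in_itv/= => /andP[c1 c2] /andP[h1 h2].
  move=> /andP[c1' c2'] /andP[h1' h2']; rewrite expr1.
  apply: energy_lip; try lra.
  move=> q /ler_normlP[q1 q2].
  apply: le_trans (HK q a c b c' b' _ _ _ _ _ _) _; try (by apply/ler_normlP; split; lra).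
  + by apply/andP; split; lra.
  + by apply/andP; split; lra.
  + by apply/andP; split; lra.
  rewrite (mulrC 2) -mulrA ler_wpM2l// mulr2n mulrDl mul1r lerD//.
    by rewrite prod_normE /= le_max lexx.
  by rewrite prod_normE /= le_max lexx orbT.
rewrite inE => -[/= cC]; rewrite in_itv/= => /andP[b1p b2p] pmin.
exists p.1, p.2; split; first lra.
move=> c' b' b0'; have [cb|/(far _ _ b0')] := boolP ((- C0 <= c' <= C0) && (b1 <= b' <= b2)).
  by apply: (pmin (c', b')); rewrite inE; move/andP: cb => [? ?]; split; rewrite /= in_itv.
apply: le_trans; apply: (pmin (0, a)); rewrite inE; split; rewrite /= in_itv/=.
  by apply/andP; split; lra.
by apply/andP; split; lra.
Qed.

(* The first-order conditions for [c + i b] to minimise [energy a]; they turn out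
   to be sufficient. *)
Definition barycenter a c b := [/\ 0 < b, E (fun q => k a c b q * (q - c)) = 0 &
  E (fun q => k a c b q * ((q - c) ^+ 2 + a ^+ 2)) = b ^+ 2 * E (k a c b)].

Lemma E_dpsi_gt0 a c b : 0 < a -> 0 < b -> 0 < E (k a c b).
Proof.
move=> a0 b0; have dgt q := dpsi_gt0 (hcosh_ge1 q c a0 b0).
apply: (@mean_gt0 _ _ _ P X M mX X_le _ set0) => //; first exact: mbounded_dpsi.
- by move=> q _; rewrite ltW.
- by rewrite preimage_set0 measure0 eq_sym onee_eq0.
Qed.

Lemma mbounded_dpsiM a c b g : 0 < a -> 0 < b -> mbounded M g ->
  mbounded M (fun q => k a c b q * g q).
Proof. by move=> a0 b0 ag; apply: mboundedM => //; exact: mbounded_dpsi. Qed.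

Lemma mbounded_qc c : mbounded M (fun q => q - c). Proof. exact: mboundedB. Qed.

Lemma mbounded_qca c a : mbounded M (fun q => (q - c) ^+ 2 + a).
Proof. by apply: mboundedD => //; apply: mboundedX; exact: mbounded_qc. Qed.

Lemma E_dpsi_quad a c b r s t : 0 < a -> 0 < b ->
  E (fun q => k a c b q * (r * ((q - c) ^+ 2 + a ^+ 2) + s * (q - c) + t)) =
  r * E (fun q => k a c b q * ((q - c) ^+ 2 + a ^+ 2)) +
  s * E (fun q => k a c b q * (q - c)) + t * E (k a c b).
Proof.
move=> a0 b0.
have a1 : mbounded M (fun q => k a c b q * ((q - c) ^+ 2 + a ^+ 2)).
  by apply: mbounded_dpsiM => //; exact: mbounded_qca.
have a2 : mbounded M (fun q => k a c b q * (q - c)).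
  by apply: mbounded_dpsiM => //; exact: mbounded_qc.
have a3 := mbounded_dpsi c a0 b0.
rewrite -!E_Z// -!E_D//; first last.
- by apply: mboundedM.
- by apply: mboundedM.
- by apply: mboundedM.
- by apply: mboundedD; apply: mboundedM.
by apply: eq_E => q _; ring.
Qed.

(** The two conditions determine, up to the factor [E (k a c b)], the weighted mean of every
    quadratic polynomial in [q]. Hyperbolic cosines and Poisson ratios are such polynomials, so
    their weighted means are computed by expanding them in this basis. *)
Lemma barycenter_quad a c b r s t : 0 < a -> barycenter a c b ->
  E (fun q => k a c b q * (r * ((q - c) ^+ 2 + a ^+ 2) + s * (q - c) + t)) =
  (r * b ^+ 2 + t) * E (k a c b).
Proof. by move=> a0 [b0 E1 E2]; rewrite E_dpsi_quad// E1 E2; ring. Qed.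

(** The tangent of the concave [psi] bounds the energy from above, so at a minimum the last mean is
    nonnegative for all [c'] and [b']. First-order conditions follow without differentiating under
    the integral. *)
Lemma energy_tangent a c b c' b' : 0 < a -> 0 < b -> 0 < b' ->
  energy a c' b' <= energy a c b +
    E (fun q => k a c b q * (hcosh q a c' b' - hcosh q a c b)).
Proof.
move=> a0 b0 b0'.
have ad : mbounded M (fun q => k a c b q * (hcosh q a c' b' - hcosh q a c b)).
  by apply: mbounded_dpsiM => //; apply: mboundedB; exact: mbounded_hcosh.
rewrite /energy -E_D//; last exact: mbounded_psi.
apply: mean_le => //; [exact: mbounded_psi|by apply: mboundedD => //; exact: mbounded_psi|].
by move=> q _; apply: psi_tangent; exact: hcosh_ge1.
Qed.

Lemma energy_min_barycenter a c b : 0 < a -> 0 < b ->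
  (forall c' b', 0 < b' -> energy a c b <= energy a c' b') -> barycenter a c b.
Proof.
move=> a0 b0 Emin; have Ek := E_dpsi_gt0 c a0 b0.
have crit c' b' : 0 < b' ->
    0 <= E (fun q => k a c b q * (hcosh q a c' b' - hcosh q a c b)).
  by move=> b0'; have := energy_tangent c c' a0 b0 b0'; have := Emin c' b' b0'; lra.
set S := E (fun q => k a c b q * (q - c)).
set V := E (fun q => k a c b q * ((q - c) ^+ 2 + a ^+ 2)).
split=> //.
  have tS t : 0 <= t ^+ 2 * E (k a c b) - 2 * t * S.
    have := crit (c + t) b b0.
    rewrite (@eq_E _ (fun q => k a c b q *
      (0 * ((q - c) ^+ 2 + a ^+ 2) + (- t / (a * b)) * (q - c) + t ^+ 2 / (2 * a * b)))).
      have c0 : 0 <= 2 * a * b by rewrite ltW// !mulr_gt0.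
      rewrite E_dpsi_quad// -/S => /(mulr_ge0 c0) h; apply: le_trans h _.
      by rewrite le_eqVlt; apply/orP; left; apply/eqP; field; rewrite !gt_eqF.
    by move=> q _; congr (_ * _); rewrite /hcosh; field; rewrite !gt_eqF.
  (* This [t] minimises the quadratic; its value there is nonnegative only if [S = 0]. *)
  have := tS (S / E (k a c b)).
  rewrite (_ : _ - _ = - (S ^+ 2 / E (k a c b))); last by field; rewrite gt_eqF.
  rewrite oppr_ge0 pmulr_lle0 ?invr_gt0// => S0.
  by apply/eqP; rewrite -sqrf_eq0 eq_le S0 sqr_ge0.
have tV t : 0 < t -> 0 <= (t - b) * (b * t * E (k a c b) - V).
  move=> t0; have := crit c t t0.
  rewrite (@eq_E _ (fun q => k a c b q *
    (((b - t) / (2 * a * b * t)) * ((q - c) ^+ 2 + a ^+ 2) + 0 * (q - c)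
      + (t - b) / (2 * a)))).
    have c0 : 0 <= 2 * a * b * t by rewrite ltW// !mulr_gt0.
    rewrite E_dpsi_quad// -/V => /(mulr_ge0 c0) h; apply: le_trans h _.
    by rewrite le_eqVlt; apply/orP; left; apply/eqP; field; rewrite !gt_eqF.
  by move=> q _; congr (_ * _); rewrite /hcosh; field; rewrite !gt_eqF.
have V0 : 0 <= V.
  apply: (@mean_ge0 _ _ _ P X M X_le) => q _; apply: mulr_ge0; last by rewrite addr_ge0 ?sqr_ge0.
  exact: ltW (dpsi_gt0 (hcosh_ge1 _ _ a0 b0)).
pose v := V / (b * E (k a c b)).
have VE : V = b * v * E (k a c b) by rewrite /v; field; rewrite !gt_eqF.
have v0 : 0 <= v by rewrite /v divr_ge0// mulr_ge0// ltW.
suff h : V = b * b * E (k a c b) by apply: etrans h _; rewrite expr2.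
(* The expression in [tV] is a positive multiple of [(t - b) * (t - v)], which is negative at the
   midpoint unless [b = v]. *)
have /tV : 0 < (b + v) / 2 by lra.
rewrite VE.
rewrite (_ : _ * _ = - ((b - v) ^+ 2 * (b * E (k a c b) / 4))); last by field.
rewrite oppr_ge0 pmulr_lle0; last by rewrite divr_gt0// mulr_gt0.
move=> bv; have : (b - v) ^+ 2 == 0 by rewrite eq_le bv sqr_ge0.
by rewrite sqrf_eq0 subr_eq0 => /eqP <-.
Qed.

Lemma barycenter_exists a : 0 < a -> exists c b, barycenter a c b.
Proof.
move=> a0; have [c [b [b0 Emin]]] := energy_min a0.
by exists c, b; apply: energy_min_barycenter.
Qed.

(* Quantitative uniqueness: a barycenter for [a] has less energy than any other
   point, by at least half the squared distance. *)
Lemma barycenter_energy a c b c' b' : 0 < a -> barycenter a c b -> 0 < b' ->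
  energy a c b + psi (hcosh c b c' b') <= energy a c' b'.
Proof.
move=> a0 Bcb b0'; have [b0 _ _] := Bcb; set D' := hcosh c b c' b'.
have D1 q := hcosh_ge1 q c a0 b0.
have D1' : 1 <= D' by exact: hcosh_ge1.
have ad : mbounded M (fun q => k a c b q * (hcosh q a c b * D' - hcosh q a c' b')).
  apply: mbounded_dpsiM => //; apply: mboundedB; [apply: mboundedM|] => //; exact: mbounded_hcosh.
(* The inner products of the CAT(0) inequality at [c + i b] average to zero, because [c + i b] is
   critical; integrating that inequality then gives the claim. *)
have E0 : E (fun q => k a c b q * (hcosh q a c b * D' - hcosh q a c' b')) = 0.
  rewrite (@eq_E _ (fun q => k a c b q *
    ((D' / (2 * a * b) - (2 * a * b')^-1) * ((q - c) ^+ 2 + a ^+ 2) +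
      (c' - c) / (a * b') * (q - c) +
      (D' * b / (2 * a) - ((c - c') ^+ 2 + b' ^+ 2) / (2 * a * b'))))).
    rewrite barycenter_quad// (_ : _ + _ = 0) ?mul0r// /D' /hcosh.
    by field; rewrite !gt_eqF.
  by move=> q _; congr (_ * _); rewrite /hcosh; field; rewrite !gt_eqF.
rewrite /energy -(mean_cst P X (psi D')) -E_D//; last exact: mbounded_psi.
rewrite -[leLHS]subr0 -[X in _ - X](mulr0 (dpsi D')) -E0 -E_Z//.
rewrite -E_B//; last 2 first.
- by apply: mboundedD => //; exact: mbounded_psi.
- by apply: mboundedM.
apply: mean_le => //; last first.
- move=> q _; rewrite mulrA (mulrC (dpsi D')); apply: psi_cat0 => //; first exact: hcosh_ge1.
  exact: hcosh_cat0.
- exact: mbounded_psi.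
by apply: mboundedB; [apply: mboundedD => //; exact: mbounded_psi|apply: mboundedM].
Qed.

End Barycenter.

(** * Dependence of the barycenter on the height of the horocycle *)

Lemma psi_gt0 {R : realType} (D : R) : 1 < D -> 0 < psi D.
Proof.
move=> D1; rewrite /psi divr_gt0// exprn_gt0// (lt_le_trans (ln_gt0 D1))//.
exact/ln_le_arcosh/ltW.
Qed.

(** With [D = cosh rho], [rho > 0], this is [ln (cosh rho) <= rho <= rho * coth rho]. *)
Lemma ln_le_dpsiM {R : realType} (D : R) : 1 <= D -> ln D <= dpsi D * D.
Proof.
move=> D1; rewrite (le_trans (ln_le_arcosh D1))// -dpsi_sinh//.
rewrite ler_pM2l ?dpsi_gt0//.
have D0 : 0 <= D by lra.
rewrite -[leRHS]ger0_norm// -sqrtr_sqr ler_sqrt ?sqr_ge0//; lra.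
Qed.

Section BarycenterCurve.
Context {R : realType} {d : measure_display} {T : measurableType d}.
Variables (P : probability T R) (X : T -> R) (M : R).
Hypothesis mX : measurable_fun [set: T] X.
Hypothesis X_le : forall t, `|X t| <= M.
Hypothesis M_gt0 : 0 < M.
Hypothesis X_neq_cst : forall c, P (X @^-1` [set c]) != 1%E.
Implicit Types a b c q : R.

Notation E := (mean P X).
Notation k a c b := (fun q => dpsi (hcosh q a c b)).

Let mb_cst := mbounded_cst M.
Let mb_id := mbounded_id M.
Let E_le := @mean_le _ _ _ P X M mX X_le.
Let E_ge0 := @mean_ge0 _ _ _ P X M X_le.
Let E_gt0 := @mean_gt0 _ _ _ P X M mX X_le.
Let eq_E := @eq_mean _ _ _ P X M X_le.
Let E_quad := @barycenter_quad _ _ _ P X M mX X_le.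
Let Ek_gt0 := @E_dpsi_gt0 _ _ _ P X M mX X_le.

Let dpsi_hcosh_gt0 q a c b : 0 < a -> 0 < b -> 0 < dpsi (hcosh q a c b).
Proof. by move=> a0 b0; apply: dpsi_gt0; exact: hcosh_ge1. Qed.

(** The first condition makes [c] a weighted average of points of [[-M, M]]. *)
Lemma barycenter_norm_le a c b : 0 < a -> barycenter P X a c b -> `|c| <= M.
Proof.
move=> a0 B; have [b0 _ _] := B; have Ek := Ek_gt0 c a0 b0.
have h1 : 0 <= E (fun q => k a c b q * (0 * ((q - c) ^+ 2 + a ^+ 2) + 1 * (q - c) + (M + c))).
  apply: E_ge0 => q /ler_normlP[q1 q2].
  by apply: mulr_ge0; [exact/ltW/dpsi_hcosh_gt0 | lra].
have h2 : 0 <= E (fun q => k a c b q * (0 * ((q - c) ^+ 2 + a ^+ 2) + -1 * (q - c) + (M - c))).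
  apply: E_ge0 => q /ler_normlP[q1 q2].
  by apply: mulr_ge0; [exact/ltW/dpsi_hcosh_gt0 | lra].
move: h1 h2; rewrite !E_quad// !pmulr_lge0// => h1 h2.
by apply/ler_normlP; split; lra.
Qed.

(** The second condition makes [b ^+ 2 - a ^+ 2] the weighted average of [(q - c) ^+ 2], which is
    positive as [X] is not constant. *)
Lemma barycenter_lt a c b : 0 < a -> barycenter P X a c b -> a < b.
Proof.
move=> a0 B; have [b0 _ _] := B; have Ek := Ek_gt0 c a0 b0.
suff : 0 < E (fun q => k a c b q * (1 * ((q - c) ^+ 2 + a ^+ 2) + 0 * (q - c) + (- a ^+ 2))).
  rewrite E_quad// pmulr_lgt0// mul1r subr_gt0 ltr_pXn2r ?nnegrE//; exact: ltW.
have -> : E (fun q => k a c b q * (1 * ((q - c) ^+ 2 + a ^+ 2) + 0 * (q - c) + (- a ^+ 2))) =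
  E (fun q => k a c b q * (q - c) ^+ 2).
  by apply: eq_E => q _; ring.
apply: (E_gt0 (A := [set c])) => //.
- by apply: mbounded_dpsiM => //; apply: mboundedX; exact: mbounded_qc.
- by move=> q _; apply: mulr_ge0; [exact/ltW/dpsi_hcosh_gt0 | exact: sqr_ge0].
- move=> q _ qc; apply: mulr_gt0; first exact: dpsi_hcosh_gt0.
  by rewrite exprn_even_gt0//= subr_eq0; apply/eqP => qcE; apply: qc; exact: qcE.
Qed.

Lemma barycenter_le a c b : 0 < a -> barycenter P X a c b -> b <= a + 2 * M.
Proof.
have M0 := M_gt0.
move=> a0 B; have [b0 _ _] := B; have Ek := Ek_gt0 c a0 b0.
have := barycenter_norm_le a0 B => /ler_normlP[c1 c2].
have : 0 <= E (fun q => k a c b q * (-1 * ((q - c) ^+ 2 + a ^+ 2) + 0 * (q - c)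
    + ((2 * M) ^+ 2 + a ^+ 2))).
  apply: E_ge0 => q /ler_normlP[q1 q2].
  apply: mulr_ge0; first exact/ltW/dpsi_hcosh_gt0.
  have : 0 <= (2 * M - (q - c)) * (2 * M + (q - c)) by rewrite mulr_ge0//; lra.
  lra.
rewrite E_quad// pmulr_lge0// => h.
have aM : 0 <= a * M by rewrite ltW// mulr_gt0.
rewrite -(@ler_pXn2r _ 2)// ?nnegrE; [lra|exact: ltW|lra].
Qed.

Definition variance_of : R := E (fun q => (q - E (fun q => q)) ^+ 2).

Lemma variance_of_gt0 : 0 < variance_of.
Proof.
apply: (E_gt0 (A := [set E (fun q => q)])) => //.
- by apply: mboundedX; exact: mbounded_qc.
- by move=> q _; exact: sqr_ge0.
- move=> q _ qc.
  by rewrite exprn_even_gt0//= subr_eq0; apply/eqP => qcE; apply: qc; exact: qcE.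
Qed.

Lemma variance_of_le c : variance_of <= E (fun q => (q - c) ^+ 2).
Proof.
set m := E (fun q => q).
have -> : E (fun q => (q - c) ^+ 2) =
    E (fun q => (q - m) ^+ 2 + 2 * (m - c) * (q - m) + (m - c) ^+ 2).
  by apply: eq_E => q _; ring.
have a1 : mbounded M (fun q => (q - m) ^+ 2) by apply: mboundedX; exact: mbounded_qc.
have a2 : mbounded M (fun q => 2 * (m - c) * (q - m)) by apply: mboundedM => //; exact: mbounded_qc.
rewrite !(@meanD _ _ _ P X M)//; last exact: mboundedD.
rewrite (@meanZ _ _ _ P X M)//; last exact: mbounded_qc.
rewrite (@meanB _ _ _ P X M)// !mean_cst -/m subrr mulr0 addr0 lerDl sqr_ge0//.
Qed.

(** The barycenter conditions and [dpsi <= 1] give [E (k D) <= b / a] for [D = hcosh q a c b].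
    Below, [k D >= ln D], and the concavity of [ln] extracts the factor
    [(q - c) ^+ 2 / (2 * M) ^+ 2], whose mean involves the variance. As [b] stays bounded, this
    makes [b / a] tend to infinity as [a] tends to [0]. *)
Lemma barycenter_ratio a c b : 0 < a -> barycenter P X a c b ->
  variance_of / (2 * M) ^+ 2 * ln (1 + 2 * M ^+ 2 / (a * b)) <= b / a.
Proof.
have M0 := M_gt0.
move=> a0 B; have [b0 _ _] := B; have Ek := Ek_gt0 c a0 b0.
have /ler_normlP[c1 c2] := barycenter_norm_le a0 B.
set l := ln _.
have l0 : 0 <= l by rewrite ln_ge0// lerDl divr_ge0 ?ltW// !mulr_gt0.
have M20 : 0 < (2 * M) ^+ 2 by rewrite exprn_gt0// mulr_gt0.
apply: (@le_trans _ _ (l / (2 * M) ^+ 2 * E (fun q => (q - c) ^+ 2))).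
  rewrite mulrAC mulrC (mulrC variance_of) mulrA.
  by rewrite (mulrC (_^-1)) ler_wpM2l ?variance_of_le// divr_ge0// ltW.
have aqc : mbounded M (fun q => (q - c) ^+ 2) by apply: mboundedX; exact: mbounded_qc.
have akD : mbounded M (fun q => k a c b q * hcosh q a c b).
  by apply: mbounded_dpsiM => //; exact: mbounded_hcosh.
rewrite -(@meanZ _ _ _ P X M)//.
apply: (@le_trans _ _ (E (fun q => k a c b q * hcosh q a c b))).
  apply: E_le => //; first exact: mboundedM.
  move=> q /ler_normlP[q1 q2].
  apply: le_trans (ln_le_dpsiM (hcosh_ge1 q c a0 b0)).
  have qc : 0 <= (q - c) ^+ 2 / (2 * M) ^+ 2 <= 1.
    rewrite divr_ge0 ?sqr_ge0//=.
    rewrite ler_pdivrMr// mul1r.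
    have : 0 <= (2 * M - (q - c)) * (2 * M + (q - c)) by rewrite mulr_ge0//; lra.
    lra.
  rewrite mulrAC -mulrA mulrC; apply: le_trans (ln_chord qc _) _.
    by rewrite divr_ge0// ltW// !mulr_gt0.
  have e0 : 0 <= (q - c) ^+ 2 / (2 * a * b).
    by rewrite divr_ge0 ?sqr_ge0// ltW// !mulr_gt0.
  have -> : (q - c) ^+ 2 / (2 * M) ^+ 2 * (2 * M ^+ 2 / (a * b)) =
     (q - c) ^+ 2 / (2 * a * b) by field; rewrite !gt_eqF.
  rewrite ler_ln ?posrE; [|lra|by rewrite (lt_le_trans ltr01)// hcosh_ge1].
  rewrite hcoshE// lerD2l ler_wpM2r// ?lerDl ?sqr_ge0//.
  by rewrite invr_ge0 ltW// !mulr_gt0.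
rewrite (@eq_E _ (fun q => k a c b q * ((2 * a * b)^-1 * ((q - c) ^+ 2 + a ^+ 2)
   + 0 * (q - c) + b / (2 * a)))).
  rewrite E_quad// (_ : _ + _ = b / a); last by field; rewrite !gt_eqF.
  rewrite ler_piMr//; first by rewrite divr_ge0// ltW.
  rewrite -(mean_cst P X 1); apply: E_le => //; first exact: mbounded_dpsi.
  by move=> q _; apply: dpsi_le1; exact: hcosh_ge1.
by move=> q _; congr (_ * _); rewrite /hcosh; field; rewrite !gt_eqF.
Qed.

(** Each barycenter beats the other for its own energy by [psi] of their distance. Adding the two
    inequalities bounds this [psi] by the change of energy between [a] and [a'], and [psi_chord]
    converts it into a squared Euclidean distance. *)
Lemma barycenter_holder l : 0 < l -> exists H, forall a a' c b c' b',
  l <= a <= 1 -> l <= a' <= 1 -> barycenter P X a c b -> barycenter P X a' c' b' ->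
  (c - c') ^+ 2 + (b - b') ^+ 2 <= H * `|a - a'|.
Proof.
have aux (x y z w p t : R) : - (x - y) <= t -> z - w <= t -> x + p <= z -> w + p <= y -> p <= t.
  by lra.
have aux' (x y z w N : R) : `|x| <= N -> `|y| <= N -> 0 <= z -> 0 <= w -> z <= N ->
    w <= N -> (x - y) ^+ 2 + (z - w) ^+ 2 <= 5 * N ^+ 2.
  move=> /ler_normlP[? ?] /ler_normlP[? ?] ? ? ? ?.
  have : 0 <= (2 * N - (x - y)) * (2 * N + (x - y)) by rewrite mulr_ge0//; lra.
  have : 0 <= (N - (z - w)) * (N + (z - w)) by rewrite mulr_ge0//; lra.
  lra.
have M0 := M_gt0.
(* [N] bounds all coordinates, since [b <= a + 2 * M] and [a <= 1]. *)
move=> l0; have [N NE] : exists N, N = 1 + 2 * M by eexists.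
have N1 : 1 <= N by lra.
have N0 : 0 < N by lra.
have MN : M <= N by lra.
have [K K0 HK] := hcosh_lip N l0.
have [D0 D0E] : exists D0, D0 = 1 + 5 * N ^+ 2 / (2 * l ^+ 2) by eexists.
have D01 : 1 < D0 by rewrite D0E ltrDl divr_gt0// mulr_gt0// exprn_gt0.
have pD0 := psi_gt0 D01.
exists (2 * N ^+ 2 * ((D0 - 1) / psi D0) * K) => a a' c b c' b' /andP[a1 a2] /andP[a1' a2'] B B'.
have [a0 a0'] : 0 < a /\ 0 < a' by split; lra.
have [b0 _ _] := B; have [b0' _ _] := B'.
have cN := le_trans (barycenter_norm_le a0 B) MN.
have cN' := le_trans (barycenter_norm_le a0' B') MN.
have bl : l <= b by exact/ltW/(le_lt_trans a1)/(barycenter_lt a0 B).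
have bl' : l <= b' by exact/ltW/(le_lt_trans a1')/(barycenter_lt a0' B').
have bN : b <= N by apply: le_trans (barycenter_le a0 B) _; rewrite NE lerD2r.
have bN' : b' <= N by apply: le_trans (barycenter_le a0' B') _; rewrite NE lerD2r.
have aN : l <= a <= N by rewrite a1 (le_trans a2 N1).
have aN' : l <= a' <= N by rewrite a1' (le_trans a2' N1).
have HE x y : `|x| <= N -> l <= y <= N -> 0 < y ->
    `|energy P X a x y - energy P X a' x y| <= K * `|a - a'|.
  move=> xN yN y0; apply: (@energy_lip _ _ _ P X M mX X_le) => // q qM.
  (* By symmetry of the distance, a change of [a] is a vertical move of the second point. *)
  rewrite !(hcoshC q); have qN := le_trans qM MN.
  by apply: le_trans (HK _ _ _ _ _ _ xN qN qN yN aN aN') _; rewrite subrr normr0 add0r.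
have /ler_normlP[h1 _] := HE c b cN (introT andP (conj bl bN)) b0.
have /ler_normlP[_ h2] := HE c' b' cN' (introT andP (conj bl' bN')) b0'.
have e1 := @barycenter_energy _ _ _ P X M mX X_le a c b c' b' a0 B b0'.
have e2 := @barycenter_energy _ _ _ P X M mX X_le a' c' b' c b a0' B' b0.
rewrite hcoshC in e2.
have psiK : psi (hcosh c b c' b') <= K * `|a - a'| := aux _ _ _ _ _ _ h1 h2 e1 e2.
have D1 := hcosh_ge1 c c' b0 b0'.
have Z0 : 0 <= (c - c') ^+ 2 + (b - b') ^+ 2 by rewrite addr_ge0 ?sqr_ge0.
have l2 : l ^+ 2 <= b * b' by rewrite expr2 ler_pM// ltW.
have N2 : b * b' <= N ^+ 2 by rewrite expr2 ler_pM// ltW.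
have bb0 : 0 < b * b' by rewrite mulr_gt0.
have D'0 : hcosh c b c' b' <= D0.
  rewrite hcoshE// D0E lerD2l ler_pM//.
  - by rewrite invr_ge0 ltW// !mulr_gt0.
  - by apply: aux'; rewrite ?(ltW b0) ?(ltW b0').
  - by rewrite lef_pV2 ?posrE ?mulr_gt0 ?exprn_gt0// -mulrA ler_pM2l.
have := psi_chord D1 D'0.
have -> : hcosh c b c' b' - 1 = ((c - c') ^+ 2 + (b - b') ^+ 2) / (2 * b * b').
  by rewrite hcoshE//; ring.
set Z := _ + _ in Z0 * => h.
have {}h : psi D0 * (Z / (2 * b * b')) <= K * `|a - a'| * (D0 - 1).
  by apply: le_trans h _; rewrite ler_wpM2r// subr_ge0 ltW.
have -> : 2 * N ^+ 2 * ((D0 - 1) / psi D0) * K * `|a - a'| =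
  2 * N ^+ 2 / psi D0 * (K * `|a - a'| * (D0 - 1)) by field; rewrite gt_eqF.
apply: (@le_trans _ _ (2 * N ^+ 2 / psi D0 * (psi D0 * (Z / (2 * b * b'))))); last first.
  by rewrite ler_wpM2l// divr_ge0// ?ltW// mulr_gt0// exprn_gt0.
have -> : 2 * N ^+ 2 / psi D0 * (psi D0 * (Z / (2 * b * b'))) = Z * (N ^+ 2 / (b * b')).
  by field; rewrite !gt_eqF.
by rewrite ler_peMr// ler_pdivlMr// mul1r.
Qed.

Lemma barycenter_curve : exists a c b,
  [/\ 0 < a, barycenter P X a c b & a * b * ((a + b) ^+ 2 + c ^+ 2) = (a + b) ^+ 2].
Proof.
have M0 := M_gt0.
have /choice[p pB] (a : R) : exists p : R * R, 0 < a -> barycenter P X a p.1 p.2.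
  have [a0|a0] := ltP 0 a.
    have [c [b B]] := barycenter_exists P mX X_le M_gt0 a0.
    by exists (c, b).
  by exists (0, 0).
pose h a := a * (p a).2 * ((a + (p a).2) * (a + (p a).2) + (p a).1 * (p a).1) -
  (a + (p a).2) * (a + (p a).2).
have v0 := variance_of_gt0.
(* The choice of [a0] gives [a0 * b <= (2 + e)^-1], so the logarithm in [barycenter_ratio] is at
   least [L], and [L] is chosen to yield [b / a0 >= 2 * M ^+ 2]. *)
pose L := 2 * M ^+ 2 / (variance_of / (2 * M) ^+ 2).
have [e eE] : exists e, e = expR L / (2 * M ^+ 2) by eexists.
have M20 : 0 < 2 * M ^+ 2 by rewrite mulr_gt0// exprn_gt0.
have e0 : 0 < e by rewrite eE divr_gt0 ?expR_gt0.
have [a0 a0E] : exists a0, a0 = ((1 + 2 * M) * (2 + e))^-1 by eexists.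
have den0 : 0 < (1 + 2 * M) * (2 + e) by rewrite mulr_gt0//; lra.
have a00 : 0 < a0 by rewrite a0E invr_gt0.
have a01 : a0 <= 1 by rewrite a0E invf_le1//; nra.
have h1 : 0 <= h 1.
  rewrite /h -!expr2; have := barycenter_lt ltr01 (pB _ ltr01).
  set b := (p 1).2; set c := (p 1).1 => b1.
  have := sqr_ge0 c; have := sqr_ge0 (1 + b); nra.
have h0 : h a0 <= 0.
  have B := pB _ a00; rewrite /h -!expr2.
  have := barycenter_lt a00 B; have := barycenter_le a00 B.
  have := barycenter_norm_le a00 B; have := barycenter_ratio a00 B.
  set b := (p a0).2; set c := (p a0).1 => rat /ler_normlP[c1 c2] bM ab.
  have ab1 : a0 * b <= (2 + e)^-1.
    apply: (@le_trans _ _ (a0 * (1 + 2 * M))); first by rewrite ler_pM2l//; lra.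
    by rewrite a0E invfM mulrAC mulVf ?mul1r// gt_eqF//; lra.
  have ab0 : 0 < a0 * b by rewrite mulr_gt0//; lra.
  have ab2 : a0 * b <= 2^-1.
    by apply: le_trans ab1 _; rewrite lef_pV2 ?posrE//; lra.
  have eab : 2 + e <= (a0 * b)^-1 by rewrite -[leLHS]invrK lef_pV2 ?posrE// invr_gt0; lra.
  have {}rat : 2 * M ^+ 2 <= b / a0.
    apply: le_trans rat; have vM : 0 < variance_of / (2 * M) ^+ 2.
      by rewrite divr_gt0// exprn_gt0// mulr_gt0.
    rewrite -(ler_pdivrMl _ _ vM) [leLHS]mulrC -/L -[leLHS]expRK ler_ln ?posrE ?expR_gt0//.
      have -> : expR L = 2 * M ^+ 2 * e by rewrite eE mulrC divfK// gt_eqF.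
      have : 2 * M ^+ 2 * e <= 2 * M ^+ 2 / (a0 * b) by rewrite ler_pM2l//; lra.
      lra.
    by rewrite ltr_wpDr// divr_ge0// ltW.
  have {}rat : 2 * M ^+ 2 * a0 <= b by rewrite -ler_pdivlMr.
  have cM : c ^+ 2 <= M ^+ 2.
    have : 0 <= (M - c) * (M + c) by rewrite mulr_ge0//; lra.
    lra.
  (* The two terms of the left-hand side are each at most half of [(a0 + b) ^+ 2]. *)
  have t1 : a0 * b * (a0 + b) ^+ 2 <= 2^-1 * (a0 + b) ^+ 2 by rewrite ler_wpM2r ?sqr_ge0.
  have t2 : a0 * b * c ^+ 2 <= 2^-1 * b ^+ 2.
    apply: (@le_trans _ _ (a0 * b * M ^+ 2)); first by rewrite ler_wpM2l// ltW.
    have : b * (2 * M ^+ 2 * a0) <= b * b by rewrite ler_wpM2l//; lra.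
    lra.
  have t3 : b ^+ 2 <= (a0 + b) ^+ 2 by rewrite ler_pXn2r ?nnegrE//; lra.
  lra.
have [H HB] := barycenter_holder a00.
have pcont : {within `[a0, 1], continuous (fun a => (p a).1)} /\
    {within `[a0, 1], continuous (fun a => (p a).2)}.
  split; apply: (@holder_within_continuous _ _ _ _ 1 H) => x y /=; rewrite !in_itv/= => xa ya;
    rewrite real_normK ?num_real//.
  - apply: le_trans (HB _ _ _ _ _ _ xa ya (pB _ _) (pB _ _)); [by rewrite lerDl sqr_ge0|lra|lra].
  - apply: le_trans (HB _ _ _ _ _ _ xa ya (pB _ _) (pB _ _)); [by rewrite lerDr sqr_ge0|lra|lra].
have hcont : {within `[a0, 1], continuous h}.
  have [c1 c2] := pcont.
  have cid : {within `[a0, 1], continuous (fun a : R => a)}.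
    by apply: continuous_subspaceT => x; exact: cvg_id.
  move=> x; have FF : Filter (nbhs x) by exact: nbhs_filter.
  have /(_ FF) s := cvgD (cid x) (c2 x); have /(_ FF) s2 := cvgM s s.
  have /(_ FF) ab := cvgM (cid x) (c2 x); have /(_ FF) cc := cvgM (c1 x) (c1 x).
  have /(_ FF) s2cc := cvgD s2 cc; have /(_ FF) t := cvgM ab s2cc.
  by have /(_ FF) := cvgB t s2; apply.
have [|a] := IVT (v := 0) a01 hcont.
  by rewrite ge_min h0 le_max h1 orbT.
rewrite in_itv/= => /andP[a1 a2] /eqP; rewrite subr_eq0 -!expr2 => /eqP ha.
exists a, (p a).1, (p a).2; split => //; last by apply: pB; lra.
by lra.
Qed.

End BarycenterCurve.

(** * Means of Busemann functions *)

Lemma quadratic_roots {R : realType} (u v w : R) : u != 0 \/ v != 0 ->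
  exists x1 x2, forall x, u * x ^+ 2 + v * x + w = 0 -> x = x1 \/ x = x2.
Proof.
move=> uv; have [[x1 rx1]|nox] := pselect (exists x, u * x ^+ 2 + v * x + w = 0); last first.
  by exists 0, 0 => x rx; exfalso; apply: nox; exists x.
(* The second root comes from Vieta's formula; if [u = 0] it is a dummy value, as [x1] is then the
   only root. *)
exists x1, (- v / u - x1) => x rx.
have : (x - x1) * (u * (x + x1) + v) = 0.
  by transitivity ((u * x ^+ 2 + v * x + w) - (u * x1 ^+ 2 + v * x1 + w));
    [ring | rewrite rx rx1 subrr].
move/eqP; rewrite mulf_eq0 subr_eq0 => /orP[/eqP|/eqP h]; first by left.
have [u0|u0] := eqVneq u 0; last first.
  by right; apply: (mulfI u0); move: h; rewrite mulrBr mulrCA divff// mulr1; lra.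
by move: uv h; rewrite u0 eqxx mul0r add0r => -[//|/eqP].
Qed.

Lemma ln_sqrD_lip {R : realType} (a B x y : R) : 0 < a -> `|x| <= B -> `|y| <= B ->
  `|ln (x ^+ 2 + a ^+ 2) - ln (y ^+ 2 + a ^+ 2)| <= 2 * B / a ^+ 2 * `|x - y|.
Proof.
move=> a0; suff H u v : `|u| <= B -> `|v| <= B ->
    ln (u ^+ 2 + a ^+ 2) - ln (v ^+ 2 + a ^+ 2) <= 2 * B / a ^+ 2 * `|u - v|.
  move=> xB yB; rewrite ler_norml H// andbT.
  by have := H y x yB xB; rewrite distrC; lra.
move=> uB vB; have a20 : 0 < a ^+ 2 by rewrite exprn_gt0.
have pos z : 0 < z ^+ 2 + a ^+ 2 by rewrite ltr_wpDl// sqr_ge0.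
rewrite lerBlDl; apply: le_trans (ln_tangent (pos u) (pos v)) _; rewrite lerD2l.
have -> : (u ^+ 2 + a ^+ 2) / (v ^+ 2 + a ^+ 2) - 1 = (u + v) * (u - v) / (v ^+ 2 + a ^+ 2).
  by field; rewrite gt_eqF.
apply: le_trans (ler_norm _) _; rewrite !normrM normfV mulrAC ler_wpM2r//.
apply: ler_pM => //.
  by apply: le_trans (ler_normD _ _) _; rewrite mulr_natl mulr2n lerD.
by rewrite gtr0_norm// lef_pV2 ?posrE// lerDr sqr_ge0.
Qed.

Section Contraction.
Context {R : realType} {d : measure_display} {T : measurableType d}.
Variables (P : probability T R) (X : T -> R) (M : R).
Hypothesis mX : measurable_fun [set: T] X.
Hypothesis X_le : forall t, `|X t| <= M.
Hypothesis M_gt0 : 0 < M.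
Hypothesis X_neq2 : forall x y, P (X @^-1` [set x; y]) != 1%E.
Implicit Types a b c q s S delta : R.

Notation E := (mean P X).
Notation k a c b := (fun q => dpsi (hcosh q a c b)).

(* The quotient of the Poisson kernels [y / ((x - s)^2 + y^2)] at [c + i b] and
   [q + i a], whose logarithm is a difference of Busemann functions. *)
Definition poisson_ratio a c b s q : R :=
  b * ((q - s) ^+ 2 + a ^+ 2) / (a * ((c - s) ^+ 2 + b ^+ 2)).

Let sqrD_gt0 x a : 0 < a -> 0 < x ^+ 2 + a ^+ 2 :> R.
Proof. by move=> a0; rewrite ltr_wpDl ?sqr_ge0// exprn_gt0. Qed.

Lemma poisson_ratio_gt0 a c b s q : 0 < a -> 0 < b -> 0 < poisson_ratio a c b s q.
Proof. by move=> a0 b0; rewrite divr_gt0// mulr_gt0// sqrD_gt0. Qed.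

(* The square vanishes iff [q + i a] lies on the geodesic from [s] through
   [c + i b]. *)
Lemma poisson_ratio_hcosh a c b s q : 0 < a -> 0 < b ->
  2 * hcosh q a c b * poisson_ratio a c b s q =
  poisson_ratio a c b s q ^+ 2 + 1 +
  (((c - s) * ((q - s) ^+ 2 + a ^+ 2) - (q - s) * ((c - s) ^+ 2 + b ^+ 2)) /
    (a * ((c - s) ^+ 2 + b ^+ 2))) ^+ 2.
Proof.
move=> a0 b0; have := sqrD_gt0 (c - s) b0; rewrite /hcosh /poisson_ratio => N0.
by field; rewrite !gt_eqF.
Qed.

Lemma mbounded_poisson_ratio a c b s : mbounded M (poisson_ratio a c b s).
Proof.
apply: mboundedM; last exact: mbounded_cst.
by apply: mboundedM; [exact: mbounded_cst | exact: mbounded_qca].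
Qed.

(** The bound is [|ln A| <= A + A^-1], with [A^-1] bounded because
    [(q - s) ^+ 2 + a ^+ 2 >= a ^+ 2]. *)
Lemma mbounded_ln_poisson a c b s : 0 < a -> 0 < b ->
  mbounded M (fun q => ln (poisson_ratio a c b s q)).
Proof.
move=> a0 b0; have ap := mbounded_poisson_ratio a c b s.
apply: (mbounded_le _ (mboundedD ap (mbounded_cst M
  ((a * ((c - s) ^+ 2 + b ^+ 2)) / (b * a ^+ 2))))).
  by apply: measurableT_comp; [exact: measurable_ln | exact: ap.1].
move=> q _; have A0 := poisson_ratio_gt0 c s q a0 b0.
have A1 : (poisson_ratio a c b s q)^-1 <= a * ((c - s) ^+ 2 + b ^+ 2) / (b * a ^+ 2).
  rewrite /poisson_ratio invf_div ler_wpM2l//.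
    by rewrite mulr_ge0 ?ltW// sqrD_gt0.
  rewrite lef_pV2 ?posrE ?mulr_gt0 ?sqrD_gt0 ?exprn_gt0//.
  by rewrite ler_pM2l// lerDr sqr_ge0.
have h1 := ln_sublinear A0.
have h2 : - ln (poisson_ratio a c b s q) < (poisson_ratio a c b s q)^-1.
  by rewrite -lnV ?posrE// ln_sublinear// invr_gt0.
have h3 : 0 < (poisson_ratio a c b s q)^-1 by rewrite invr_gt0.
by apply/ler_normlP; split; lra.
Qed.

(** The chord of [ln] gives a lower bound [k (A - D)] whose mean vanishes at the barycenter.
    Equality for [q] puts [q + i a] on one geodesic ending at [s], which is a quadratic equation for
    [q - s]. *)
Lemma E_ln_poisson_gt0 a c b s : 0 < a -> barycenter P X a c b ->
  0 < E (fun q => ln (poisson_ratio a c b s q)).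
Proof.
move=> a0 B; have [b0 _ _] := B; set A := poisson_ratio a c b s.
have N0 := sqrD_gt0 (c - s) b0.
have aA : mbounded M A by exact: mbounded_poisson_ratio.
have akA : mbounded M (fun q => k a c b q * (A q - hcosh q a c b)).
  by apply: mbounded_dpsiM => //; apply: mboundedB => //; exact: mbounded_hcosh.
have alA : mbounded M (fun q => ln (A q)) by exact: mbounded_ln_poisson.
have E0 : E (fun q => k a c b q * (A q - hcosh q a c b)) = 0.
  rewrite (@eq_mean _ _ _ P X M X_le _ (fun q => k a c b q *
    ((b / (a * ((c - s) ^+ 2 + b ^+ 2)) - (2 * a * b)^-1) * ((q - c) ^+ 2 + a ^+ 2) +
     (2 * b * (c - s) / (a * ((c - s) ^+ 2 + b ^+ 2))) * (q - c) +
     (b * (c - s) ^+ 2 / (a * ((c - s) ^+ 2 + b ^+ 2)) - b / (2 * a))))).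
    rewrite (barycenter_quad mX X_le)// (_ : _ + _ = 0) ?mul0r//.
    by field; rewrite !gt_eqF.
  by move=> q _; congr (_ * _); rewrite /A /poisson_ratio /hcosh; field; rewrite !gt_eqF.
have [x1 [x2 x12]] : exists x1 x2, forall x,
    (c - s) * x ^+ 2 + (- ((c - s) ^+ 2 + b ^+ 2)) * x + (c - s) * a ^+ 2 = 0 ->
    x = x1 \/ x = x2.
  (* The leading coefficient [c - s] may vanish, but the linear one cannot. *)
  by apply: quadratic_roots; right; rewrite oppr_eq0 gt_eqF.
rewrite -[ltRHS]subr0 -[X in _ - X]E0 -(@meanB _ _ _ P X M mX X_le)//.
have A0 q : 0 < A q by exact: poisson_ratio_gt0.
have D1 q : 1 <= hcosh q a c b by exact: hcosh_ge1.
apply: (mean_gt0 mX X_le (A := [set s + x1; s + x2])) => //.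
- exact: mboundedB.
- move=> q _; rewrite subr_ge0 dpsi_chord_le_ln//.
  by rewrite poisson_ratio_hcosh// lerDl sqr_ge0.
- move=> q _ nq; rewrite subr_gt0 dpsi_chord_lt_ln// poisson_ratio_hcosh//.
  have Z0 : a * ((c - s) ^+ 2 + b ^+ 2) != 0 by rewrite gt_eqF// mulr_gt0.
  rewrite ltrDl exprn_even_gt0//= mulf_neq0//; last by rewrite invr_eq0.
  apply/eqP => q0; apply: nq.
  have [|h|h] := x12 (q - s); first by rewrite -[RHS]q0; ring.
  + by left; rewrite -h /=; ring.
  + by right; rewrite -h /=; ring.
- by apply: measurableU; exact: measurable_set1.
Qed.

Lemma E_ln_poisson_lip a c b S : 0 < a -> a <= b -> `|c| <= M -> exists K, forall s s',
  `|s| <= S -> `|s'| <= S ->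
  `|E (fun q => ln (poisson_ratio a c b s q)) -
    E (fun q => ln (poisson_ratio a c b s' q))| <= K * `|s - s'|.
Proof.
move=> a0 ab cM; have b0 := lt_le_trans a0 ab.
exists (2 * (M + S) / a ^+ 2 + 2 * (M + S) / b ^+ 2) => s s' sS sS'.
rewrite -(@meanB _ _ _ P X M mX X_le)//; [|exact: mbounded_ln_poisson..].
apply: (@le_norm_mean _ _ _ P X M mX X_le).
  by apply: mboundedB; exact: mbounded_ln_poisson.
move=> q qM.
have lnE t : ln (poisson_ratio a c b t q) =
    ln b - ln a + (ln ((q - t) ^+ 2 + a ^+ 2) - ln ((c - t) ^+ 2 + b ^+ 2)).
  rewrite /poisson_ratio ln_div ?posrE ?mulr_gt0 ?sqrD_gt0//.
  by rewrite !lnM ?posrE ?sqrD_gt0//; ring.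
have bd (x t : R) : `|x| <= M -> `|t| <= S -> `|x - t| <= M + S.
  by move=> xM tS; rewrite (le_trans (ler_normB _ _))// lerD.
have h1 := ln_sqrD_lip a0 (bd q s qM sS) (bd q s' qM sS').
have h2 := ln_sqrD_lip b0 (bd c s cM sS) (bd c s' cM sS').
have ss (x : R) : `|(x - s) - (x - s')| = `|s - s'| by rewrite distrC; congr `|_|; ring.
rewrite !ss in h1 h2; rewrite !lnE mulrDl.
apply: le_trans (lerD h1 h2); apply: le_trans (ler_normB _ _).
by rewrite le_eqVlt; apply/orP; left; apply/eqP; congr `|_|; ring.
Qed.

Lemma E_ln_poisson_far a c b delta : 0 < a -> a <= b -> `|c| <= M -> 0 < delta ->
  exists S, forall s, S <= `|s| ->
    ln (b / a) - delta <= E (fun q => ln (poisson_ratio a c b s q)).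
Proof.
move=> a0 ab cM dl0; have b0 := lt_le_trans a0 ab; have M0 := M_gt0.
have [C CE] : exists C, C = b ^+ 2 - a ^+ 2 by eexists.
have C0 : 0 <= C by rewrite CE subr_ge0 ler_pXn2r ?nnegrE// ltW.
have e0 : 0 <= 4 * (6 * M + C) / delta by rewrite divr_ge0 ?(ltW dl0)//; lra.
(* The terms ensure [|s| >= 1], [|s| <= 2 * |q - s|] and [(6 * M + C) * |s| <= delta * (q - s) ^+
   2]; the last dominates the difference of the two Poisson denominators. *)
exists (1 + 2 * M + 4 * (6 * M + C) / delta) => s sS.
rewrite -(mean_cst P X (ln (b / a) - delta)).
apply: (@mean_le _ _ _ P X M mX X_le); first exact: mbounded_cst.
  exact: mbounded_ln_poisson.
move=> q qM.
have n0 := sqrD_gt0 (q - s) a0; have N0 := sqrD_gt0 (c - s) b0.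
have -> : ln (poisson_ratio a c b s q) =
    ln (b / a) - (ln ((c - s) ^+ 2 + b ^+ 2) - ln ((q - s) ^+ 2 + a ^+ 2)).
  by rewrite /poisson_ratio !ln_div ?posrE ?mulr_gt0// !lnM ?posrE//; ring.
rewrite lerD2l lerN2 lerBlDl; apply: le_trans (ln_tangent N0 n0) _; rewrite lerD2l.
rewrite lerBlDr ler_pdivrMr//.
have s0 : 0 < `|s| by lra.
have sd : 4 * (6 * M + C) <= delta * `|s| by rewrite (mulrC delta) -ler_pdivrMr//; lra.
have qs : `|s| ^+ 2 <= 4 * (q - s) ^+ 2.
  rewrite -[(q - s) ^+ 2]real_normK ?num_real//.
  have : `|s| <= 2 * `|q - s|.
    have := ler_normD (s - q) q; rewrite subrK distrC; lra.
  by move=> h; have := ler_pM (ltW s0) (ltW s0) h h; lra.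
have cq : (c - s) ^+ 2 - (q - s) ^+ 2 <= 6 * M * `|s|.
  have -> : (c - s) ^+ 2 - (q - s) ^+ 2 = (c - q) * (c + q - 2 * s) by ring.
  apply: le_trans (ler_norm _) _; rewrite normrM.
  have h1 : `|c - q| <= 2 * M by have := ler_normB c q; lra.
  have h2 : `|c + q - 2 * s| <= 3 * `|s|.
    have := ler_normB (c + q) (2 * s); have := ler_normD c q.
    by rewrite normrM [`|2|]ger0_norm//; lra.
  by have := ler_pM (normr_ge0 _) (normr_ge0 _) h1 h2; lra.
have h : (6 * M + C) * `|s| <= delta * (q - s) ^+ 2.
  have t1 : 4 * (6 * M + C) * `|s| <= delta * `|s| * `|s| by rewrite ler_pM2r.
  have t2 : delta * `|s| ^+ 2 <= delta * (4 * (q - s) ^+ 2) by rewrite ler_pM2l.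
  lra.
have Cs : C <= C * `|s| by rewrite ler_peMr//; lra.
have da : 0 <= delta * a ^+ 2 by rewrite mulr_ge0 ?sqr_ge0// ltW.
lra.
Qed.

(** Far out the mean is at least [ln (b / a) / 2]; on the remaining compact interval it is
    continuous and positive, hence attains a positive minimum. *)
Lemma E_ln_poisson_inf_gt0 a c b : 0 < a -> barycenter P X a c b ->
  exists eps, 0 < eps /\ forall s, eps <= E (fun q => ln (poisson_ratio a c b s q)).
Proof.
have M0 := M_gt0.
move=> a0 B.
have X_neq_cst x : P (X @^-1` [set x]) != 1%E by rewrite -(setUid [set x]) X_neq2.
have ab := barycenter_lt mX X_le X_neq_cst a0 B.
have cM := barycenter_norm_le mX X_le a0 B.
have l0 : 0 < ln (b / a) by rewrite ln_gt0// ltr_pdivlMr// mul1r.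
have [|S0 farS] := E_ln_poisson_far a0 (ltW ab) cM (_ : 0 < ln (b / a) / 2).
  by rewrite divr_gt0.
pose S := `|S0|.
have [K HK] := E_ln_poisson_lip S a0 (ltW ab) cM.
pose F s := E (fun q => ln (poisson_ratio a c b s q)).
have inS x : (- S <= x <= S) = (`|x| <= S) by rewrite ler_norml.
have cF : {within `[- S, S], continuous F}.
  apply: (@holder_within_continuous _ _ _ _ 0 K) => x y /=.
  by rewrite !in_itv/= !inS expr1 => xS yS; exact: HK.
have [|s0 _ s0min] := EVT_min _ cF; first by rewrite /S; have := normr_ge0 S0; lra.
have Fs0 : 0 < F s0 by exact: E_ln_poisson_gt0.
exists (Num.min (F s0) (ln (b / a) / 2)); split; first by rewrite lt_min Fs0 divr_gt0.
move=> s; rewrite ge_min; have [sS|Ss] := leP `|s| S.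
  by rewrite [F s0 <= _]s0min// in_itv/= inS.
apply/orP; right; apply: le_trans (farS s _); first lra.
by apply: le_trans (ltW Ss); exact: ler_norm.
Qed.

End Contraction.

(** * Return to [zeta] and the kernel *)

Lemma sqr_norm_zeta (R : realType) (a b c : R) : 0 < a -> 0 < b ->
  a * b * ((a + b) ^+ 2 + c ^+ 2) = (a + b) ^+ 2 ->
  (b * c / (a + b)) ^+ 2 + b ^+ 2 = b / a.
Proof.
move=> a0 b0 abc; have ab0 : 0 < a + b by rewrite addr_gt0.
apply: (@mulIf _ (a * (a + b) ^+ 2)); first by rewrite mulf_neq0 ?gt_eqF// exprn_gt0.
have -> : b / a * (a * (a + b) ^+ 2) = b * (a + b) ^+ 2 by field; rewrite gt_eqF.
transitivity (b * (a * b * ((a + b) ^+ 2 + c ^+ 2))); last by rewrite abc.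
by field; rewrite gt_eqF.
Qed.

(** Solving [c = (1 + 1/L) Re zeta] with [L = b / a] gives the real part of [zeta], and the equation
    of the curve says [|zeta|^2 = L]. So [1 / zeta] has imaginary part [- a], and
    [s = w + Re zeta / L] turns both moduli into Poisson denominators. *)
Lemma kernel5p1E (R : realType) (a c b w q : R) : 0 < a -> 0 < b ->
  a * b * ((a + b) ^+ 2 + c ^+ 2) = (a + b) ^+ 2 ->
  kernel5p1 ((b * c / (a + b)) +i* b)%C w q =
  ln (poisson_ratio a c b (w + a * c / (a + b)) q).
Proof.
move=> a0 b0 abc; rewrite /kernel5p1 /poisson_ratio; set x := b * c / (a + b).
have ab0 : 0 < a + b by rewrite addr_gt0.
have zE : x ^+ 2 + b ^+ 2 = b / a by exact: sqr_norm_zeta.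
have n0 u v : 0 <= u ^+ 2 + v ^+ 2 :> R by rewrite addr_ge0 ?sqr_ge0.
congr ln; rewrite /= !sqr_sqrtr// !zE.
have N0 : (x - w) ^+ 2 + b ^+ 2 != 0 by rewrite gt_eqF// ltr_wpDl ?sqr_ge0// exprn_gt0.
have -> : c - (w + a * c / (a + b)) = x - w by rewrite /x; field; rewrite gt_eqF.
rewrite !(mul0r, addr0, subr0, add0r, oppr0) -/x !sqrrN.
have -> : b / (b / a) = a by field; rewrite !gt_eqF.
have -> : w - x = - (x - w) by ring.
have -> : w + x / (b / a) - q = - (q - (w + a * c / (a + b))).
  by rewrite /x; field; rewrite !gt_eqF.
by rewrite !sqrrN; field; rewrite N0 !gt_eqF.
Qed.

Theorem theorem5p1 (R : realType) (d : measure_display) (T : measurableType d)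
  (P : probability T R) (Q : {RV P >-> R})
  (Hbdd : exists M : R, {ae P, forall t, `|Q t| <= M})
  (Hsupp : forall a b : R, P (Q @^-1` [set a; b]) != 1%E) :
  exists zeta : R[i], 0 < complex.Im zeta /\ 1 < Normc.normc zeta /\
    exists eps : R, 0 < eps /\
      forall w : R, (eps%:E <= \int[P]_t (kernel5p1 zeta w (Q t))%:E)%E.
Proof.
case: Hbdd => M0 [N [mN PN0 QN]]; pose M : R := `|M0| + 1.
have M_gt0 : 0 < M by rewrite ltr_wpDl.
(* Truncation makes the almost sure bound hold everywhere and changes [Q] only on the null set
   [N]. *)
pose X t := Num.max (- M) (Num.min M (Q t)).
have mX : measurable_fun [set: T] X.
  by apply: measurable_maxr => //; apply: measurable_minr.
have X_le t : `|X t| <= M.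
  by rewrite ler_norml /X le_max lexx /= ge_max ge_min lexx /= andbT; lra.
have XQ t : ~ N t -> X t = Q t.
  move=> nNt; have /ler_normlP[Q1 Q2] : `|Q t| <= M.
    have [//|nQ] := pselect (`|Q t| <= M0); first by move=> /le_trans; apply;
      rewrite /M; have := ler_norm M0; lra.
    by exfalso; apply/nNt/QN.
  by rewrite /X (min_idPr Q2) (max_idPr _)//; lra.
have X_neq2 (x y : R) : P (X @^-1` [set x; y]) != 1%E.
  have mxy : measurable [set x; y] by apply: measurableU; exact: measurable_set1.
  have mXxy : measurable (X @^-1` [set x; y]) by rewrite -[X in measurable X]setTI; exact: mX.
  have mQxy : measurable (Q @^-1` [set x; y]).
    by rewrite -[X in measurable X]setTI; exact: (measurable_funP Q).
  apply: contra (Hsupp x y) => /eqP PX; rewrite eq_le probability_le1//= -PX.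
  apply: (@le_trans _ _ (P (Q @^-1` [set x; y] `|` N))).
    apply: le_measure; rewrite ?inE//; first exact: measurableU.
    move=> t Xt; have [Nt|nNt] := pselect (N t); [by right | left].
    by rewrite /= -XQ.
  by apply: le_trans (measureU2 _ _ _) _ => //; rewrite [X in (_ + X)%E](_ : _ = 0%E) ?adde0.
have [a [c [b [a0 B abc]]]] : exists a c b,
    [/\ 0 < a, barycenter P X a c b & a * b * ((a + b) ^+ 2 + c ^+ 2) = (a + b) ^+ 2].
  (* A singleton is the pair [[set x; x]], so [X] is in particular not almost surely constant. *)
  by apply: (barycenter_curve mX X_le M_gt0) => x; rewrite -(setUid [set x]).
have [b0 _ _] := B.
have ab : a < b.
  by apply: (barycenter_lt mX X_le _ a0 B) => x; rewrite -(setUid [set x]).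
have [eps [eps0 Heps]] := E_ln_poisson_inf_gt0 mX X_le M_gt0 X_neq2 a0 B.
exists ((b * c / (a + b)) +i* b)%C; split => //; split.
  rewrite /= sqr_norm_zeta// -[ltLHS]sqrtr1 ltr_sqrt ?divr_gt0//.
  by rewrite ltr_pdivlMr// mul1r.
exists eps; split => // w; have adl := mbounded_ln_poisson M c (w + a * c / (a + b)) a0 b0.
have -> : (\int[P]_t (kernel5p1 (b * c / (a + b) +i* b)%C w (Q t))%:E)%E =
    (\int[P]_t (ln (poisson_ratio a c b (w + a * c / (a + b)) (X t)))%:E)%E.
  apply: ae_eq_integral => //.
  - apply/measurable_EFinP.
    under [X in measurable_fun _ X]eq_fun do rewrite kernel5p1E//.
    exact: (measurableT_comp adl.1).
  - by apply/measurable_EFinP; exact: (measurableT_comp adl.1).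
  - exists N; split => // t /= tN; apply: contrapT => nNt; apply: tN => _.
    by rewrite kernel5p1E// XQ.
apply: (@le_trans _ _ (mean P X (fun q => ln (poisson_ratio a c b (w + a * c / (a + b)) q)))%:E).
  by rewrite lee_fin.
rewrite /mean /Rintegral fineK//; apply: integrable_fin_num => //.
exact: (mbounded_integrable P mX X_le adl).
Qed.
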